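(* There exist numbers $\beta,\varrho\in(0,1]$, both irrational with bounded continued fraction entries and neither with eventually periodic continued fraction expansion, such that: (i) for every $\alpha\in(0,1)$ and every $x\in\Omega_1(\beta)$, $\lim_{n\to\infty}\ln(n)\,\mathcal{P}_1^n(v_{\beta,\alpha})(x)=\big(\int v_{\beta,\alpha}\,\mathrm{d}\lambda\big)h_1(x)$; (ii) for every $\alpha\in(0,1/2)$ and every $x\in\Omega_1(\varrho)$, $\lim_{n\to\infty}\ln(n)\,\mathcal{P}_1^n(v_{\varrho,\alpha})(x)=\big(\int v_{\varrho,\alpha}\,\mathrm{d}\lambda\big)h_1(x)$; (iii) for every $\alpha\in(1/2,1)$ and every $x\in\Omega_1(\varrho)$, $\liminf_{n\to\infty}\ln(n)\,\mathcal{P}_1^n(v_{\varrho,\alpha})(x)=\big(\int v_{\varrho,\alpha}\,\mathrm{d}\lambda\big)h_1(x)$ and $\limsup_{n\to\infty}\ln(n)\,\mathcal{P}_1^n(v_{\varrho,\alpha})(x)=+\infty$.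
   Context: $T_1$ is the Farey map: $T_1(x)=\frac{x}{1-x}$ for $0\le x\le1/2$, $T_1(x)=\frac{1-x}{x}$ for $1/2<x\le1$, inverse branches $f_{1,0}(x)=\frac{x}{1+x}$, $f_{1,1}(x)=\frac1{1+x}$; $\mathcal{P}_1(f)=|f_{1,0}'|\, f\circ f_{1,0}+|f_{1,1}'|\, f\circ f_{1,1}$; $h_1(x)=1/x$; $\lambda$ is Lebesgue measure. For $\tau\in[0,1]$, $\alpha\in(0,1)$, $v_{\tau,\alpha}(x)=|\tau-x|^{-\alpha}$. $\Omega_1(\tau)=\bigcap_{k\ge0}\overline{\{T_1^\ell(\tau):\ell\ge k\}}$ is the $\omega$-limit set of $\tau$ under $T_1$. *)

(* Defs.v *)
From Stdlib Require Import Reals Lra Lia ZArith.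
Open Scope R_scope.

Definition T1 (x : R) : R :=
  if Rle_dec x (1/2) then x / (1 - x) else (1 - x) / x.

Fixpoint T1iter (n : nat) (x : R) : R :=
  match n with O => x | S m => T1 (T1iter m x) end.

Definition f10 (x : R) : R := x / (1 + x).
Definition f11 (x : R) : R := 1 / (1 + x).

(* transfer operator: |f10'(x)| = |f11'(x)| = 1/(1+x)^2 *)
Definition P1 (f : R -> R) (x : R) : R :=
  Rabs (1 / (1 + x) ^ 2) * f (f10 x) + Rabs (- (1 / (1 + x) ^ 2)) * f (f11 x).

Fixpoint P1n (n : nat) (f : R -> R) : R -> R :=
  match n with O => f | S m => P1 (P1n m f) end.

Definition h1 (x : R) : R := 1 / x.

(* v_{tau,alpha}(x) = |tau - x|^{-alpha}  (at x = tau, Stdlib's Rpower gives 1) *)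
Definition v (tau alpha : R) (x : R) : R := Rpower (Rabs (tau - x)) (- alpha).

Definition Omega1 (tau x : R) : Prop :=
  forall k : nat, forall eps : R, eps > 0 ->
    exists l : nat, (l >= k)%nat /\ Rabs (T1iter l tau - x) < eps.

(* improper Lebesgue/Riemann integral over [0,1] of a function f that is
   Riemann integrable away from a single singularity tau in (0,1):
   I = lim_{a -> tau-, b -> tau+} (int_0^a f + int_b^1 f). *)
Definition improper_integral01 (f : R -> R) (tau I : R) : Prop :=
  forall eps : R, eps > 0 -> exists delta : R, delta > 0 /\
    forall a b : R, 0 < tau - a < delta -> 0 < b - tau < delta ->
      0 <= a -> b <= 1 ->
      exists (pr1 : Riemann_integrable f 0 a) (pr2 : Riemann_integrable f b 1),
        Rabs (RiemannInt pr1 + RiemannInt pr2 - I) < eps.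

Fixpoint cf_rem (x : R) (n : nat) : R :=
  match n with
  | O => x
  | S m => / cf_rem x m - IZR (Int_part (/ cf_rem x m))
  end.

(* cf_entry x n = a_{n+1} *)
Definition cf_entry (x : R) (n : nat) : Z := Int_part (/ cf_rem x n).

Definition irrational (x : R) : Prop :=
  ~ exists p q : Z, q <> 0%Z /\ x = IZR p / IZR q.

Definition cf_bounded (x : R) : Prop :=
  exists M : Z, forall n : nat, (cf_entry x n <= M)%Z.

Definition cf_eventually_periodic (x : R) : Prop :=
  exists N p : nat, (p > 0)%nat /\
    forall n : nat, (n >= N)%nat -> cf_entry x (n + p) = cf_entry x n.

Definition is_liminf (u : nat -> R) (L : R) : Prop :=
  (forall eps : R, eps > 0 -> exists N : nat, forall n : nat, (n >= N)%nat -> u n > L - eps) /\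
  (forall eps : R, eps > 0 -> forall N : nat, exists n : nat, (n >= N)%nat /\ u n < L + eps).

Definition limsup_is_pinfty (u : nat -> R) : Prop :=
  forall M : R, forall N : nat, exists n : nat, (n >= N)%nat /\ u n > M.

(* Main.v *)
(* For the Farey map put [a_n(x) = x P^n F(x)].  If [x F(x)] is nondecreasing and concave on [0,1], so is
   every [a_n]; moreover [a_{n+1}(1) = a_n(1/2)], so [a_n(1)] decreases.  Bounding the conserved integral
   of [P^n F] from both sides by multiples of [a_n(1)] gives [ln n * a_n(1) -> int F].  Every C^2 function
   is a difference of two members of this cone, hence [ln n * P^n H(x) -> (int H) / x] for all of them.

   Let [t_n] be the orbit of [tau], of bounded type.  Following the inverse branch through [tau] splits
   [P^n v] into a singular term [sing n] and the contributions [side m], [m < n], of the sibling branches.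
   Each [side m] is smooth and exponentially small in [m], so these sum up to the expected limit by
   dominated convergence, and everything depends on [ln n * sing n].  If [d_n] is the denominator of the
   branch, [sing n] is of the order of [d_n^(2 alpha - 2) |t_n - x|^(-alpha)].

   The digits of [tau] are taken to be 1 except for 2's at sparse places, so the omega-limit set
   consists of [[1,1,...]] and the [[1,...,1,2,1,1,...]]; then [d_n] is about [phi^n], and [|t_n - x|]
   is about [phi^(-2M)], where [M] is the length of agreement of the codes.  For quadratic places of the
   2's, [M = o(n)] and the singular term always vanishes; for the places [2^k], [M] is at most
   [n + O(1)] and this is attained infinitely often, so the threshold is [alpha = 1/2]. *)

Require Import Defs.
From Stdlib Require Import Reals Lra Lia Psatz ZArith List Classical.
From Coquelicot Require Import Coquelicot.
Open Scope R_scope.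

(** * The transfer operator *)

(** The weight [x] in [x F x] is [1 / h1], so the cone conditions bear on the density of [F]
    relative to the invariant one; that measure is infinite, whence the decay like [1 / ln n]. The
    function [v] is unbounded, so it is no difference of cone members, which are continuous; the
    branch through the singularity has to be cut off. What makes the siblings harmless is bounded
    type: the orbit stays away from [1/2], the only point that the images of the two branches share.
    The integral of [v] reappears as a telescoping sum, since [P1] conserves integrals and each
    [side m] carries off a part of the mass.

    The threshold is a matter of exponents: with agreement [M] the singular term is about
    [phi^((2 alpha - 2) n + 2 alpha M)], hence [phi^((4 alpha - 2) n)] when [M] is close to [n], and
    [ln n] is negligible beside it. Places that double serve this purpose: after a 2 at place [n]
    the code agrees with [[1,1,...]] for about [n] steps. Powers are written as [exp] of
    combinations of logarithms, which turns the product formulas along a branch into linear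
    identities. *)

Lemma P1_eq (F : R -> R) (x : R) :
  P1 F x = (F (f10 x) + F (f11 x)) / (1 + x) ^ 2.
Proof.
  unfold P1. rewrite Rabs_Ropp, Rabs_right; [unfold Rdiv; ring|].
  apply Rle_ge. unfold Rdiv. rewrite Rmult_1_l.
  destruct (Req_dec ((1 + x) ^ 2) 0) as [E|E].
  - rewrite E, Rinv_0; lra.
  - left. apply Rinv_0_lt_compat. assert (H := pow2_ge_0 (1 + x)). lra.
Qed.

Lemma f10_bounds (x : R) : 0 <= x -> 0 <= f10 x < 1.
Proof.
  intros H. unfold f10. split.
  - apply Rmult_le_pos; [lra|]. left. apply Rinv_0_lt_compat. lra.
  - apply <- Rlt_div_l; lra.
Qed.

Lemma f11_bounds (x : R) : 0 <= x <= 1 -> 1 / 2 <= f11 x <= 1.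
Proof.
  intros H. unfold f11. split.
  - apply -> Rle_div_r; lra.
  - apply <- Rle_div_l; lra.
Qed.

Lemma f1_dom (x : R) : 0 <= x <= 1 -> 0 <= f10 x <= 1 /\ 0 <= f11 x <= 1.
Proof.
  intros H. assert (A := f10_bounds x (proj1 H)). assert (B := f11_bounds x H). lra.
Qed.

Lemma P1_le (F G : R -> R) (x : R) :
  (forall y, 0 <= y <= 1 -> F y <= G y) -> 0 <= x <= 1 -> P1 F x <= P1 G x.
Proof.
  intros H Hx. rewrite !P1_eq. destruct (f1_dom x Hx) as [A B].
  apply Rmult_le_compat_r.
  - left. apply Rinv_0_lt_compat. apply pow_lt. lra.
  - assert (U := H _ A). assert (V := H _ B). lra.
Qed.

Lemma P1n_le (F G : R -> R) (n : nat) :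
  (forall y, 0 <= y <= 1 -> F y <= G y) ->
  forall x, 0 <= x <= 1 -> P1n n F x <= P1n n G x.
Proof.
  intros H. induction n as [|n IH]; simpl; [exact H|].
  intros x Hx. now apply P1_le.
Qed.

Lemma P1n_ext (F G : R -> R) (n : nat) :
  (forall y, 0 <= y <= 1 -> F y = G y) ->
  forall x, 0 <= x <= 1 -> P1n n F x = P1n n G x.
Proof.
  intros H x Hx. apply Rle_antisym; apply P1n_le; auto; intros y Hy; rewrite (H y Hy); lra.
Qed.

Lemma P1n_comb (a b : R) (F G : R -> R) (n : nat) (x : R) :
  P1n n (fun y => a * F y + b * G y) x = a * P1n n F x + b * P1n n G x.
Proof.
  revert x. induction n as [|n IH]; intros x; simpl; [reflexivity|].
  rewrite !P1_eq, !IH. unfold Rdiv. ring.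
Qed.

Lemma P1n_zero (n : nat) (x : R) : P1n n (fun _ => 0) x = 0.
Proof.
  revert x. induction n as [|n IH]; intros x; simpl; [reflexivity|].
  rewrite P1_eq, !IH. unfold Rdiv. ring.
Qed.

Lemma P1n_nonneg (F : R -> R) (n : nat) (x : R) :
  (forall y, 0 <= y <= 1 -> 0 <= F y) -> 0 <= x <= 1 -> 0 <= P1n n F x.
Proof.
  intros H Hx. rewrite <- (P1n_zero n x). now apply P1n_le.
Qed.

Lemma ex_derive_continuousR (f : R -> R) (x : R) : ex_derive f x -> continuous f x.
Proof. apply (ex_derive_continuous f x). Qed.

Lemma continuous_f10 (x : R) : 0 <= x -> continuous f10 x.
Proof.
  intros H. apply ex_derive_continuousR. unfold f10. auto_derive. lra.
Qed.

Lemma continuous_f11 (x : R) : 0 <= x -> continuous f11 x.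
Proof.
  intros H. apply ex_derive_continuousR. unfold f11. auto_derive. lra.
Qed.

Definition continuous01 (F : R -> R) : Prop := forall x, 0 <= x <= 1 -> continuous F x.

Lemma P1_continuous01 (F : R -> R) : continuous01 F -> continuous01 (P1 F).
Proof.
  intros H x Hx. destruct (f1_dom x Hx) as [A B].
  apply continuous_ext with (fun x => mult (plus (F (f10 x)) (F (f11 x))) (/ (1 + x) ^ 2)).
  { intros y. rewrite P1_eq. reflexivity. }
  apply @continuous_mult.
  - apply @continuous_plus; apply continuous_comp; auto;
      [apply continuous_f10|apply continuous_f11]; lra.
  - apply ex_derive_continuousR. auto_derive. apply Rgt_not_eq. nra.
Qed.

Lemma P1n_continuous01 (F : R -> R) (n : nat) : continuous01 F -> continuous01 (P1n n F).
Proof.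
  intros H. induction n; simpl; [exact H|]. now apply P1_continuous01.
Qed.

Lemma continuous01_ex_RInt (F : R -> R) (a b : R) :
  continuous01 F -> 0 <= a <= 1 -> 0 <= b <= 1 -> ex_RInt F a b.
Proof.
  intros H Ha Hb. apply (ex_RInt_continuous F). intros z Hz. apply H.
  assert (0 <= Rmin a b) by (apply Rmin_glb; lra).
  assert (Rmax a b <= 1) by (apply Rmax_lub; lra). lra.
Qed.

Lemma continuous01_bound (F : R -> R) :
  continuous01 F -> exists M, 0 <= M /\ forall x, 0 <= x <= 1 -> Rabs (F x) <= M.
Proof.
  intros H. destruct (continuity_ab_maj (fun x => Rabs (F x)) 0 1) as [m [Hm Hm1]]; [lra| |].
  - intros x Hx. apply continuity_pt_filterlim.
    apply (continuous_comp F Rabs x); [now apply H|]. apply continuous_Rabs.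
  - exists (Rabs (F m)). split; [apply Rabs_pos|exact Hm].
Qed.

Lemma RInt_P1 (F : R -> R) : continuous01 F -> RInt (P1 F) 0 1 = RInt F 0 1.
Proof.
  intros H.
  assert (H0 : is_RInt (fun y => scal (/ (1 + y) ^ 2) (F (f10 y))) 0 1 (RInt F (f10 0) (f10 1))).
  { apply (is_RInt_comp F f10 (fun y => / (1 + y) ^ 2)); rewrite Rmin_left, Rmax_right by lra.
    - intros x Hx. apply H. apply (f1_dom x Hx).
    - intros x Hx. split.
      + unfold f10. auto_derive; [lra|]. field. lra.
      + apply ex_derive_continuousR. auto_derive. apply Rgt_not_eq. nra. }
  assert (H1 : is_RInt (fun y => scal (- / (1 + y) ^ 2) (F (f11 y))) 0 1 (RInt F (f11 0) (f11 1))).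
  { apply (is_RInt_comp F f11 (fun y => - / (1 + y) ^ 2)); rewrite Rmin_left, Rmax_right by lra.
    - intros x Hx. apply H. apply (f1_dom x Hx).
    - intros x Hx. split.
      + unfold f11. auto_derive; [lra|]. field. lra.
      + apply ex_derive_continuousR. auto_derive. apply Rgt_not_eq. nra. }
  assert (H2 := is_RInt_minus _ _ _ _ _ _ H0 H1).
  apply (is_RInt_unique (V := R_CompleteNormedModule)) in H2.
  rewrite (RInt_ext _ (P1 F)) in H2.
  2:{ intros x _. rewrite P1_eq. unfold minus, plus, opp, scal, Rdiv; simpl; unfold mult; simpl. ring. }
  rewrite H2.
  replace (f10 0) with 0 by (unfold f10; field).
  replace (f10 1) with (1/2) by (unfold f10; field).
  replace (f11 0) with 1 by (unfold f11; field).
  replace (f11 1) with (1/2) by (unfold f11; field).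
  rewrite <- (opp_RInt_swap F (1/2) 1) by (apply continuous01_ex_RInt; auto; lra).
  rewrite <- (RInt_Chasles F 0 (1/2) 1) by (apply continuous01_ex_RInt; auto; lra).
  unfold minus. now rewrite opp_opp.
Qed.

Lemma RInt_P1n (F : R -> R) (n : nat) : continuous01 F -> RInt (P1n n F) 0 1 = RInt F 0 1.
Proof.
  intros H. induction n as [|n IH]; simpl; [reflexivity|].
  rewrite RInt_P1; auto using P1n_continuous01.
Qed.

(** * An invariant cone *)

Definition concave01 (f : R -> R) : Prop :=
  forall u w l, 0 <= u <= 1 -> 0 <= w <= 1 -> 0 <= l <= 1 ->
    l * f u + (1 - l) * f w <= f (l * u + (1 - l) * w).

Definition nondecreasing01 (f : R -> R) : Prop :=
  forall u w, 0 <= u -> u <= w -> w <= 1 -> f u <= f w.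

Definition in_cone (F : R -> R) : Prop :=
  (forall x, 0 <= x <= 1 -> 0 <= F x) /\
  nondecreasing01 (fun x => x * F x) /\ concave01 (fun x => x * F x) /\ continuous01 F.

(** This is [P1] acting on [f y = y * F y]: for [b = 1/(1+x)] the two preimages of [x] are [1 - b]
    and [b]. It is symmetric under [b -> 1 - b]. *)
Definition fold_sym (f : R -> R) (b : R) : R := b * f (1 - b) + (1 - b) * f b.

Lemma convex_comb_dom (u w l : R) :
  0 <= u <= 1 -> 0 <= w <= 1 -> 0 <= l <= 1 -> 0 <= l * u + (1 - l) * w <= 1.
Proof. intros; split; nra. Qed.

(* Chebyshev's inequality for the two opposite monotonicities. *)
Lemma weighted_concave (f : R -> R) :
  nondecreasing01 f -> concave01 f -> concave01 (fun b => (1 - b) * f b).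
Proof.
  intros Hm Hc u w l Hu Hw Hl.
  assert (D := convex_comb_dom u w l Hu Hw Hl).
  assert (H := Hc u w l Hu Hw Hl).
  assert (K : 0 <= (f w - f u) * (w - u)).
  { destruct (Rle_dec u w) as [L|L].
    - assert (f u <= f w) by (apply Hm; lra). nra.
    - assert (f w <= f u) by (apply Hm; lra). nra. }
  apply Rle_trans with ((1 - (l * u + (1 - l) * w)) * (l * f u + (1 - l) * f w)).
  - assert (0 <= l * (1 - l)) by nra.
    assert (0 <= l * (1 - l) * ((f w - f u) * (w - u))) by nra.
    nra.
  - apply Rmult_le_compat_l; lra.
Qed.

Lemma fold_sym_concave (f : R -> R) :
  nondecreasing01 f -> concave01 f -> concave01 (fold_sym f).
Proof.
  intros Hm Hc u w l Hu Hw Hl. unfold fold_sym.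
  assert (A := weighted_concave f Hm Hc u w l Hu Hw Hl).
  assert (B := weighted_concave f Hm Hc (1 - u) (1 - w) l ltac:(lra) ltac:(lra) Hl).
  simpl in A, B.
  replace (l * (1 - u) + (1 - l) * (1 - w)) with (1 - (l * u + (1 - l) * w)) in B by ring.
  replace (1 - (1 - u)) with u in B by ring.
  replace (1 - (1 - w)) with w in B by ring.
  replace (1 - (1 - (l * u + (1 - l) * w))) with (l * u + (1 - l) * w) in B by ring.
  lra.
Qed.

(* A concave function symmetric about 1/2 peaks there. *)
Lemma fold_sym_decr (f : R -> R) (u w : R) :
  nondecreasing01 f -> concave01 f -> 1 / 2 <= u -> u <= w -> w <= 1 ->
  fold_sym f w <= fold_sym f u.
Proof.
  intros Hm Hc Hu Huw Hw.
  destruct (Req_dec w (1/2)) as [E|E].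
  { replace w with u by lra. lra. }
  assert (S : fold_sym f (1 - w) = fold_sym f w).
  { unfold fold_sym. replace (1 - (1 - w)) with w by ring. ring. }
  set (l := (u + w - 1) / (2 * w - 1)).
  assert (Hl : 0 <= l <= 1).
  { unfold l; split.
    - apply Rmult_le_pos; [lra|]. left. apply Rinv_0_lt_compat. lra.
    - apply <- Rle_div_l; lra. }
  assert (H := fold_sym_concave f Hm Hc w (1 - w) l ltac:(lra) ltac:(lra) Hl).
  rewrite S in H.
  replace (l * w + (1 - l) * (1 - w)) with u in H by (unfold l; field; lra).
  lra.
Qed.

Lemma P1_fold_sym (F : R -> R) (x : R) : 0 <= x ->
  x * P1 F x = fold_sym (fun y => y * F y) (/ (1 + x)).
Proof.
  intros Hx. rewrite P1_eq. unfold fold_sym, f10, f11.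
  replace (1 - / (1 + x)) with (x / (1 + x)) by (field; lra).
  replace (1 / (1 + x)) with (/ (1 + x)) by (field; lra).
  field. lra.
Qed.

Lemma inv_1p_dom (x : R) : 0 <= x <= 1 -> 1 / 2 <= / (1 + x) <= 1.
Proof.
  intros H. replace (/ (1 + x)) with (f11 x) by (unfold f11; field; lra). now apply f11_bounds.
Qed.

(** On [x F x] the operator acts as [fold_sym] composed with [1/(1+x)], which is convex, decreasing
    and takes values in [[1/2, 1]]. There [fold_sym] is concave and nonincreasing, so the composite
    is concave and nondecreasing. *)
Lemma P1_in_cone (F : R -> R) : in_cone F -> in_cone (P1 F).
Proof.
  intros [Hp [Hm [Hc Hk]]]. split; [|split; [|split]].
  - intros x Hx. apply (P1n_nonneg F 1 x Hp Hx).
  - intros u w Hu Huw Hw. rewrite !P1_fold_sym by lra.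
    apply fold_sym_decr; auto.
    + apply inv_1p_dom; lra.
    + apply Rinv_le_contravar; lra.
    + apply inv_1p_dom; lra.
  - intros u w l Hu Hw Hl.
    assert (D := convex_comb_dom u w l Hu Hw Hl).
    rewrite !P1_fold_sym by lra.
    assert (Bu := inv_1p_dom u Hu). assert (Bw := inv_1p_dom w Hw).
    assert (Bx := inv_1p_dom _ D).
    eapply Rle_trans.
    + apply fold_sym_concave; auto; lra.
    + apply fold_sym_decr; auto; [lra| |nra].
      apply Rminus_le_0.
      replace (l * / (1 + u) + (1 - l) * / (1 + w) - / (1 + (l * u + (1 - l) * w)))
        with (l * (1 - l) * (u - w) ^ 2 * (/ (1 + u) * / (1 + w) * / (1 + (l * u + (1 - l) * w))))
        by (field; lra).
      apply Rmult_le_pos; [|repeat apply Rmult_le_pos; lra].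
      apply Rmult_le_pos; [nra|apply pow2_ge_0].
  - now apply P1_continuous01.
Qed.

Lemma P1n_in_cone (F : R -> R) (n : nat) : in_cone F -> in_cone (P1n n F).
Proof.
  intros H. induction n; simpl; [exact H|]. now apply P1_in_cone.
Qed.

(** * Asymptotics of [P1n] on the cone *)

(** The graph of the concave [x F x] lies above its chord from the origin, where it vanishes. *)
Lemma cone_ge_at_1 (F : R -> R) (s : R) : in_cone F -> 0 < s <= 1 -> F 1 <= F s.
Proof.
  intros [_ [_ [Hc _]]] Hs.
  assert (H := Hc 1 0 s ltac:(lra) ltac:(lra) ltac:(lra)). simpl in H.
  replace (s * 1 + (1 - s) * 0) with s in H by ring.
  apply Rmult_le_reg_l with s; lra.
Qed.

Lemma P1_at_1 (F : R -> R) : P1 F 1 = 1 / 2 * F (1 / 2).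
Proof.
  rewrite P1_eq. unfold f10, f11. replace (1 + 1) with 2 by ring. field.
Qed.

Lemma cone_decr_at_1 (F : R -> R) (n k : nat) : in_cone F -> (n <= k)%nat ->
  P1n k F 1 <= P1n n F 1.
Proof.
  intros H L. induction L as [|k L IH]; [lra|].
  apply Rle_trans with (2 := IH). simpl. rewrite P1_at_1.
  destruct (P1n_in_cone F k H) as [_ [Hm _]].
  assert (K := Hm (1/2) 1 ltac:(lra) ltac:(lra) ltac:(lra)). lra.
Qed.

(** In the recursion the branch [f10] carries the induction hypothesis and [f11] contributes at
    least the value at 1, which is itself at least [P1n n F 1]. The profile [k / ((1 + k x)(1 + x))]
    is a subsolution of this recursion, and its integral grows like [ln k]. *)
Lemma cone_lower (F : R -> R) (n k : nat) (x : R) : in_cone F -> (k <= n)%nat -> 0 <= x <= 1 ->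
  P1n n F 1 * (INR k / ((1 + INR k * x) * (1 + x))) <= P1n k F x.
Proof.
  intros H. revert x. induction k as [|k IH]; intros x Hk Hx.
  - simpl. unfold Rdiv. rewrite Rmult_0_l, Rmult_0_r. now apply H.
  - simpl P1n. rewrite P1_eq. destruct (f1_dom x Hx) as [D0 _].
    assert (A0 := IH _ ltac:(lia) D0).
    assert (B := f11_bounds x Hx).
    assert (A1 := cone_ge_at_1 _ (f11 x) (P1n_in_cone F k H) ltac:(lra)).
    assert (A2 := cone_decr_at_1 F k n H ltac:(lia)).
    assert (A3 : 0 <= P1n n F 1) by (apply P1n_nonneg; [apply H|lra]).
    assert (Hp := pos_INR k). rewrite S_INR.
    apply Rle_trans with ((P1n n F 1 * (INR k / ((1 + INR k * f10 x) * (1 + f10 x))) + P1n n F 1)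
                            / (1 + x) ^ 2).
    2:{ apply Rmult_le_compat_r; [|lra]. left. apply Rinv_0_lt_compat. apply pow_lt. lra. }
    assert (0 <= INR k * x) by nra.
    apply Rminus_le_0.
    replace (_ - _) with (P1n n F 1 * (INR k * x ^ 2 /
       ((1 + 2 * x) * (1 + x) ^ 2 * (1 + (INR k + 1) * x)))).
    + apply Rmult_le_pos; [lra|]. apply Rmult_le_pos.
      * apply Rmult_le_pos; [lra|apply pow2_ge_0].
      * left. apply Rinv_0_lt_compat. apply Rmult_lt_0_compat; [|nra].
        apply Rmult_lt_0_compat; [lra|]. apply pow_lt. lra.
    + unfold f10. field. repeat split; nra.
Qed.

(** By monotonicity of [y F y], the branch [f11] contributes at most [(1 + x) * P1n k F 1] before
    division by [(1 + x)^2], so a step raises the supremum by at most [P1n k F 1]. This serves near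
    0, where the bound [P1n n F 1 / x] is not integrable. *)
Lemma cone_upper (F : R -> R) (M : R) (n : nat) (x : R) : in_cone F ->
  (forall y, 0 <= y <= 1 -> F y <= M) -> 0 <= M -> 0 <= x <= 1 ->
  P1n (S n) F x <= M + sum_f_R0 (fun k => P1n k F 1) n.
Proof.
  intros H HM HM0.
  assert (Step : forall k S, 0 <= S -> (forall y, 0 <= y <= 1 -> P1n k F y <= S) ->
    forall y, 0 <= y <= 1 -> P1n (Datatypes.S k) F y <= S + P1n k F 1).
  { intros k S HS Hk y Hy. simpl. rewrite P1_eq. destruct (f1_dom y Hy) as [D0 D1].
    assert (A := Hk _ D0).
    destruct (P1n_in_cone F k H) as [Hp [Hm _]].
    assert (B := Hm (f11 y) 1 ltac:(lra) ltac:(lra) ltac:(lra)). simpl in B.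
    assert (P := Hp 1 ltac:(lra)).
    assert (P' := Hp _ D0).
    assert (E : P1n k F (f11 y) = (1 + y) * (f11 y * P1n k F (f11 y))).
    { unfold f11 at 2. field. lra. }
    apply <- Rle_div_l; [|apply pow_lt; lra].
    rewrite E. rewrite Rmult_1_l in B.
    assert ((1 + y) * (f11 y * P1n k F (f11 y)) <= (1 + y) * P1n k F 1) by (apply Rmult_le_compat_l; lra).
    assert (1 + y <= (1 + y) ^ 2) by nra.
    assert ((1 + y) * P1n k F 1 <= (1 + y) ^ 2 * P1n k F 1) by (apply Rmult_le_compat_r; lra).
    assert (1 * S <= (1 + y) ^ 2 * S) by (apply Rmult_le_compat_r; lra). lra. }
  assert (N : forall k, 0 <= P1n k F 1) by (intros k; apply P1n_nonneg; [apply H|lra]).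
  revert x. induction n as [|n IH]; intros x Hx.
  - simpl sum_f_R0. now apply (Step 0%nat M).
  - simpl sum_f_R0. rewrite <- Rplus_assoc. apply (Step (Datatypes.S n)); auto.
    apply Rplus_le_le_0_compat; auto. now apply cond_pos_sum.
Qed.

Lemma ln_nat_infty : is_lim_seq (fun n => ln (INR n)) p_infty.
Proof.
  apply (is_lim_comp_seq ln INR p_infty p_infty); [apply is_lim_ln_p| |apply is_lim_seq_INR].
  exists 0%nat. intros n _. discriminate.
Qed.

Lemma ln_nat_pos (n : nat) : (2 <= n)%nat -> 0 < ln 2 <= ln (INR n).
Proof.
  intros H. assert (2 <= INR n) by (apply (le_INR 2); lia). split.
  - rewrite <- ln_1. apply ln_increasing; lra.
  - apply ln_le; lra.
Qed.

Lemma is_lim_seq_inv_ln (c : R) : is_lim_seq (fun n => c / (ln (INR n) - ln 2)) 0.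
Proof.
  replace (Finite 0) with (Rbar_mult c (Rbar_inv p_infty)) by (simpl; f_equal; ring).
  apply is_lim_seq_scal_l. apply is_lim_seq_inv; [|discriminate].
  apply is_lim_seq_minus with p_infty (ln 2).
  - apply ln_nat_infty.
  - apply is_lim_seq_const.
  - reflexivity.
Qed.

Lemma cone_lim_at_1 (F : R -> R) : in_cone F ->
  is_lim_seq (fun n => ln (INR n) * P1n n F 1) (RInt F 0 1).
Proof.
  intros H. set (I := RInt F 0 1). set (a := fun n => P1n n F 1).
  assert (Hc : continuous01 F) by apply H.
  assert (Ha : forall n, 0 <= a n) by (intros n; apply P1n_nonneg; [apply H|lra]).
  destruct (continuous01_bound F Hc) as [M [HM0 HM]].
  assert (HM' : forall y, 0 <= y <= 1 -> F y <= M).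
  { intros y Hy. apply Rle_trans with (2 := HM y Hy). apply Rle_abs. }
  (* The conserved integral is compared with that of the minorant in [cone_lower]. *)
  assert (Up : forall n, (3 <= n)%nat -> a n * (ln (INR n) - ln 2) <= I).
  { intros n Hn. unfold I. rewrite <- (RInt_P1n F n Hc).
    assert (Hi : 3 <= INR n) by (apply (le_INR 3) in Hn; simpl in Hn; lra).
    assert (B : is_RInt (fun x => a n * (INR n / (1 + INR n * x) - / (1 + x))) 0 1
                  (minus (a n * (ln (1 + INR n * 1) - ln (1 + 1)))
                         (a n * (ln (1 + INR n * 0) - ln (1 + 0))))).
    { apply (is_RInt_derive (fun x => a n * (ln (1 + INR n * x) - ln (1 + x))));
        rewrite Rmin_left, Rmax_right by lra.
      - intros x Hx. auto_derive; [split; [|split]; auto; nra|]. field. nra.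
      - intros x Hx. apply ex_derive_continuousR. auto_derive. nra. }
    apply Rle_trans with (RInt (fun x => a n * (INR n / (1 + INR n * x) - / (1 + x))) 0 1).
    - rewrite (is_RInt_unique _ _ _ _ B). unfold minus, plus, opp; simpl.
      replace (1 + INR n * 0) with 1 by ring. rewrite Rplus_0_r, ln_1.
      assert (ln (INR n) <= ln (1 + INR n * 1)) by (apply ln_le; lra).
      replace (1 + 1) with 2 by ring.
      assert (a n * ln (INR n) <= a n * ln (1 + INR n * 1)) by (apply Rmult_le_compat_l; auto).
      lra.
    - apply RInt_le; [lra|now exists (minus (a n * (ln (1 + INR n * 1) - ln (1 + 1)))
                         (a n * (ln (1 + INR n * 0) - ln (1 + 0))))| |].
      + apply continuous01_ex_RInt; [now apply P1n_continuous01|lra|lra].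
      + intros x Hx. apply Rle_trans with (2 := cone_lower F n n x H (le_n n) ltac:(lra)).
        apply Rmult_le_compat_l; [apply Ha|].
        apply Rminus_le_0.
        replace (_ - _) with (/ ((1 + INR n * x) * (1 + x))) by (field; nra).
        left. apply Rinv_0_lt_compat. apply Rmult_lt_0_compat; nra. }
  (* The integral is cut at [1/n]: to the right, [x P^n F(x) <= a n] yields [ln n * a n]; on the
     short interval [cone_upper] yields an average of the [a k], which vanishes by Cesaro once [Up]
     has shown [a n -> 0]. *)
  assert (Lo : forall n, (1 <= n)%nat ->
     I <= ln (INR n) * a n + (M / INR n + sum_f_R0 a (pred n) / INR n)).
  { intros n Hn. unfold I. rewrite <- (RInt_P1n F n Hc).
    assert (Hi : 1 <= INR n) by (apply (le_INR 1) in Hn; simpl in Hn; lra).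
    assert (Hv : 0 < / INR n <= 1).
    { split; [apply Rinv_0_lt_compat; lra|]. rewrite <- Rinv_1. apply Rinv_le_contravar; lra. }
    assert (Hcn := P1n_continuous01 F n Hc).
    rewrite <- (RInt_Chasles _ 0 (/ INR n) 1) by (apply continuous01_ex_RInt; auto; lra).
    unfold plus; simpl. rewrite Rplus_comm. apply Rplus_le_compat.
    - assert (B : is_RInt (fun x => a n * / x) (/ INR n) 1 (minus (a n * ln 1) (a n * ln (/ INR n)))).
      { apply (is_RInt_derive (fun x => a n * ln x)); rewrite Rmin_left, Rmax_right by lra.
        - intros x Hx. auto_derive; [lra|]. field. lra.
        - intros x Hx. apply ex_derive_continuousR. auto_derive. lra. }
      apply Rle_trans with (RInt (fun x => a n * / x) (/ INR n) 1).
      + apply RInt_le; [lra|apply continuous01_ex_RInt; auto; lra|eexists; exact B|].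
        intros x Hx. apply -> Rle_div_r; [|lra].
        destruct (P1n_in_cone F n H) as [_ [Hm _]].
        assert (K := Hm x 1 ltac:(lra) ltac:(lra) ltac:(lra)). unfold a. lra.
      + rewrite (is_RInt_unique _ _ _ _ B). unfold minus, plus, opp; simpl.
        rewrite ln_1, ln_Rinv by lra. lra.
    - apply Rle_trans with (RInt (fun _ => M + sum_f_R0 a (pred n)) 0 (/ INR n)).
      + apply RInt_le; [lra|apply continuous01_ex_RInt; auto; lra|apply ex_RInt_const|].
        intros x Hx. destruct n as [|n]; [lia|]. apply cone_upper; auto. lra.
      + rewrite RInt_const. unfold scal; simpl; unfold mult; simpl. lra. }
  assert (HI : 0 <= I).
  { apply Rle_trans with (2 := Up 3%nat (le_n 3)). apply Rmult_le_pos; auto.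
    destruct (ln_nat_pos 3 ltac:(lia)). lra. }
  assert (Ha0 : is_lim_seq a 0).
  { apply is_lim_seq_le_le_loc with (fun _ => 0) (fun n => I / (ln (INR n) - ln 2)).
    - exists 3%nat. intros n Hn. split; [apply Ha|].
      apply -> Rle_div_r; [now apply Up|].
      apply Rlt_gt, Rlt_0_minus. apply ln_increasing; [lra|].
      apply (le_INR 3) in Hn. simpl in Hn. lra.
    - apply is_lim_seq_const.
    - apply is_lim_seq_inv_ln. }
  assert (Hs : is_lim_seq (fun n => M / INR n + sum_f_R0 a (pred n) / INR n) 0).
  { replace (Finite 0) with (Finite (0 + 0)) by (f_equal; ring).
    apply is_lim_seq_plus'.
    - replace (Finite 0) with (Rbar_mult M (Rbar_inv p_infty)) by (simpl; f_equal; ring).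
      apply is_lim_seq_scal_l. apply is_lim_seq_inv; [apply is_lim_seq_INR|discriminate].
    - apply is_lim_seq_Reals. apply Cesaro_1. now apply is_lim_seq_Reals. }
  apply is_lim_seq_le_le_loc with
    (fun n => I - (M / INR n + sum_f_R0 a (pred n) / INR n))
    (fun n => I + I * ln 2 / (ln (INR n) - ln 2)).
  - exists 3%nat. intros n Hn. split.
    + assert (K := Lo n ltac:(lia)). unfold a in *. lra.
    + assert (P : 0 < ln (INR n) - ln 2).
      { apply Rlt_0_minus. apply ln_increasing; [lra|].
        apply (le_INR 3) in Hn. simpl in Hn. lra. }
      replace (I + I * ln 2 / (ln (INR n) - ln 2))
        with (ln (INR n) * (I / (ln (INR n) - ln 2))) by (field; lra).
      apply Rmult_le_compat_l; [apply Rlt_le; destruct (ln_nat_pos n ltac:(lia)); lra|].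
      apply -> Rle_div_r; [now apply Up|lra].
  - replace (Finite I) with (Finite (I - 0)) by (f_equal; ring).
    apply is_lim_seq_minus'; auto. apply is_lim_seq_const.
  - replace (Finite I) with (Finite (I + 0)) by (f_equal; ring).
    apply is_lim_seq_plus'; [apply is_lim_seq_const|apply is_lim_seq_inv_ln].
Qed.

Lemma ln_nat_ratio : is_lim_seq (fun n => ln (INR n) / ln (INR (S n))) 1.
Proof.
  apply is_lim_seq_le_le_loc with (fun n => 1 - ln 2 / (ln (INR n) - ln 2)) (fun _ => 1).
  - exists 3%nat. intros n Hn.
    destruct (ln_nat_pos n ltac:(lia)) as [P1 P2].
    apply (le_INR 3) in Hn. simpl in Hn.
    assert (A : ln (INR n) <= ln (INR (S n))) by (rewrite S_INR; apply ln_le; lra).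
    assert (B : ln (INR (S n)) <= ln (INR n) + ln 2).
    { rewrite <- ln_mult by lra. rewrite S_INR. apply ln_le; lra. }
    assert (Q : 0 < ln (INR n) - ln 2) by (apply Rlt_0_minus, ln_increasing; lra).
    split; [|apply <- Rle_div_l; lra].
    apply -> Rle_div_r; [|lra].
    assert (ln 2 / (ln (INR n) - ln 2) * ln (INR (S n)) >= ln 2).
    { apply Rle_ge. apply Rle_trans with (ln 2 / (ln (INR n) - ln 2) * (ln (INR n) - ln 2)).
      - right. field. lra.
      - apply Rmult_le_compat_l; [|lra]. apply Rmult_le_pos; [lra|].
        left. now apply Rinv_0_lt_compat. }
    lra.
  - replace (Finite 1) with (Finite (1 - 0)) by (f_equal; ring).
    apply is_lim_seq_minus'; [apply is_lim_seq_const|apply is_lim_seq_inv_ln].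
  - apply is_lim_seq_const.
Qed.

Lemma ln_lim_shift (u : nat -> R) (l : R) :
  is_lim_seq (fun n => ln (INR n) * u n) l -> is_lim_seq (fun n => ln (INR n) * u (S n)) l.
Proof.
  intros H. apply is_lim_seq_incr_1 in H.
  apply is_lim_seq_ext_loc with (fun n => (ln (INR n) / ln (INR (S n))) * (ln (INR (S n)) * u (S n))).
  - exists 2%nat. intros n Hn. destruct (ln_nat_pos (S n) ltac:(lia)). field. lra.
  - replace (Finite l) with (Finite (1 * l)) by (f_equal; ring).
    apply is_lim_seq_mult'; [apply ln_nat_ratio|exact H].
Qed.

Definition mixes (F : R -> R) : Prop :=
  forall x, 0 < x <= 1 -> is_lim_seq (fun n => ln (INR n) * P1n n F x) (RInt F 0 1 / x).

Lemma f10_T (x : R) : 0 < x < 1 -> f10 (x / (1 - x)) = x.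
Proof. intros H. unfold f10. field. lra. Qed.

(** On [[1/2, 1]] the values [x P^n F(x)] are squeezed between those at [1/2] and at 1, which are
    consecutive terms of one sequence. Further left, the recursion at [z = x / (1 - x)] is solved
    for the value at the preimage [x]; the other preimage [1 - x] lies in [[1/2, 1]]. Each round
    passes from [1/(N+2)] to [1/(N+3)]. *)
Lemma cone_mixes (F : R -> R) : in_cone F -> mixes F.
Proof.
  intros H.
  assert (Top : forall x, 1 / 2 <= x <= 1 ->
     is_lim_seq (fun n => ln (INR n) * P1n n F x) (RInt F 0 1 / x)).
  { intros x Hx. assert (L := cone_lim_at_1 F H).
    apply is_lim_seq_ext with (fun n => / x * (ln (INR n) * (x * P1n n F x))).
    { intros n. field. lra. }
    replace (Finite (RInt F 0 1 / x)) with (Rbar_mult (/ x) (RInt F 0 1))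
      by (simpl; f_equal; field; lra).
    apply is_lim_seq_scal_l.
    apply is_lim_seq_le_le_loc with (2 := ln_lim_shift _ _ L) (3 := L).
    exists 2%nat. intros n Hn. destruct (ln_nat_pos n Hn) as [P Q].
    destruct (P1n_in_cone F n H) as [_ [Hm _]].
    assert (K1 := Hm (1/2) x ltac:(lra) ltac:(lra) ltac:(lra)).
    assert (K2 := Hm x 1 ltac:(lra) ltac:(lra) ltac:(lra)). simpl in K1, K2.
    simpl P1n. rewrite P1_at_1. split; apply Rmult_le_compat_l; lra. }
  assert (All : forall N x, / (INR N + 2) <= x <= 1 ->
     is_lim_seq (fun n => ln (INR n) * P1n n F x) (RInt F 0 1 / x)).
  { induction N as [|N IH]; intros x Hx.
    - apply Top. simpl in Hx. lra.
    - destruct (Rle_dec (1/2) x) as [B|B]; [apply Top; lra|].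
      assert (PN := pos_INR N). rewrite S_INR in Hx.
      assert (Hx0 : 0 < x).
      { apply Rlt_le_trans with (2 := proj1 Hx). apply Rinv_0_lt_compat. lra. }
      assert (Hxm : 1 <= x * (INR N + 1 + 2)).
      { apply Rle_trans with (/ (INR N + 1 + 2) * (INR N + 1 + 2)).
        - right. field. lra.
        - apply Rmult_le_compat_r; lra. }
      set (z := x / (1 - x)).
      assert (Hz : / (INR N + 2) <= z <= 1).
      { unfold z. split; [|apply <- Rle_div_l; lra].
        apply -> Rle_div_r; [|lra]. apply Rmult_le_reg_l with (INR N + 2); [lra|].
        rewrite <- Rmult_assoc, Rinv_r by lra. lra. }
      assert (Ez : 1 + z = / (1 - x)) by (unfold z; field; lra).
      assert (Ef : f11 z = 1 - x) by (unfold f11; rewrite Ez; field; lra).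
      assert (L1 := ln_lim_shift _ _ (IH z Hz)).
      assert (L2 := Top (1 - x) ltac:(lra)).
      assert (L3 := is_lim_seq_minus' _ _ _ _ (is_lim_seq_scal_l _ ((1 + z) ^ 2) _ L1) L2).
      replace (Finite (RInt F 0 1 / x)) with
        (Finite ((1 + z) ^ 2 * (RInt F 0 1 / z) - RInt F 0 1 / (1 - x)))
        by (f_equal; rewrite Ez; unfold z; field; lra).
      apply is_lim_seq_ext with (2 := L3).
      intros n. simpl P1n. rewrite P1_eq, Ef. unfold z at 2. rewrite f10_T by lra. rewrite Ez. field. lra. }
  intros x Hx.
  destruct (archimed (/ x)) as [A _].
  assert (P : 0 < / x) by (apply Rinv_0_lt_compat; lra).
  apply (All (Z.to_nat (up (/ x)))). split; [|lra].
  rewrite INR_IZR_INZ, Z2Nat.id by (apply le_IZR; lra).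
  apply Rle_trans with (/ / x); [apply Rinv_le_contravar; lra|rewrite Rinv_inv; lra].
Qed.

(** * From the cone to C^2 functions *)

Lemma sub_mixes (F G H : R -> R) : in_cone F -> in_cone G ->
  (forall x, 0 <= x <= 1 -> H x = F x - G x) -> mixes H.
Proof.
  intros HF HG E x Hx.
  replace (RInt H 0 1) with (RInt F 0 1 - RInt G 0 1).
  - replace ((RInt F 0 1 - RInt G 0 1) / x) with (RInt F 0 1 / x - RInt G 0 1 / x) by (field; lra).
    apply is_lim_seq_ext with (fun n => ln (INR n) * P1n n F x - ln (INR n) * P1n n G x).
    + intros n. rewrite (P1n_ext H (fun y => 1 * F y + (-1) * G y)); [|intros; rewrite E; lra|lra].
      rewrite P1n_comb. ring.
    + apply is_lim_seq_minus'; now apply cone_mixes.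
  - rewrite (RInt_ext H (fun y => minus (F y) (G y))).
    + symmetry. apply (RInt_minus (V := R_CompleteNormedModule) F G);
        apply continuous01_ex_RInt; try lra; [apply HF|apply HG].
    + intros y Hy. rewrite Rmin_left, Rmax_right in Hy by lra. rewrite E by lra. reflexivity.
Qed.

Lemma MVT_01 (f df : R -> R) (a b : R) :
  (forall x, 0 <= x <= 1 -> is_derive f x (df x)) -> 0 <= a -> a <= b -> b <= 1 ->
  exists c, a <= c <= b /\ f b - f a = df c * (b - a).
Proof.
  intros H Ha Hab Hb.
  destruct (MVT_gen f a b df) as [c [Hc E]]; try (rewrite Rmin_left, Rmax_right in * by lra).
  - intros x Hx. apply H. lra.
  - intros x Hx. apply continuity_pt_filterlim. apply ex_derive_continuousR. exists (df x).
    apply H. lra.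
  - exists c. auto.
Qed.

Lemma concave01_of_derive (f df : R -> R) :
  (forall x, 0 <= x <= 1 -> is_derive f x (df x)) ->
  (forall x y, 0 <= x -> x <= y -> y <= 1 -> df y <= df x) -> concave01 f.
Proof.
  intros H Hd.
  assert (W : forall u w l, 0 <= u -> u <= w -> w <= 1 -> 0 <= l <= 1 ->
    l * f u + (1 - l) * f w <= f (l * u + (1 - l) * w)).
  { intros u w l Hu Huw Hw Hl. set (m := l * u + (1 - l) * w).
    assert (Hm : u <= m <= w) by (unfold m; nra).
    destruct (MVT_01 f df u m H) as [c1 [Hc1 E1]]; try lra.
    destruct (MVT_01 f df m w H) as [c2 [Hc2 E2]]; try lra.
    assert (D := Hd c1 c2 ltac:(lra) ltac:(lra) ltac:(lra)).
    assert (M1 : m - u = (1 - l) * (w - u)) by (unfold m; ring).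
    assert (M2 : w - m = l * (w - u)) by (unfold m; ring).
    rewrite M1 in E1. rewrite M2 in E2.
    assert (0 <= l * (1 - l) * (w - u) * (df c1 - df c2)).
    { repeat apply Rmult_le_pos; lra. }
    assert (f u = f m - df c1 * ((1 - l) * (w - u))) by lra.
    assert (f w = f m + df c2 * (l * (w - u))) by lra.
    rewrite H1, H2. lra. }
  intros u w l Hu Hw Hl. destruct (Rle_dec u w) as [L|L].
  - apply W; lra.
  - assert (A := W w u (1 - l) ltac:(lra) ltac:(lra) ltac:(lra) ltac:(lra)).
    replace (1 - (1 - l)) with l in A by ring.
    rewrite (Rplus_comm (l * u)). lra.
Qed.

(** The function [x (3 - x)] has derivative [3 - 2 x >= 1] and second derivative [-2], and
    [3 - x >= 2]. So one [K] bounding [H] and the two derivatives of [x H x] secures positivity,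
    monotonicity and concavity together. *)
Lemma smooth_in_cone (H df ddf : R -> R) (K : R) :
  (forall x, 0 <= x <= 1 -> is_derive (fun y => y * H y) x (df x)) ->
  (forall x, 0 <= x <= 1 -> is_derive df x (ddf x)) ->
  continuous01 H ->
  (forall x, 0 <= x <= 1 -> - K <= H x /\ - K <= df x /\ ddf x <= K) -> 0 <= K ->
  in_cone (fun x => H x + K * (3 - x)).
Proof.
  intros D1 D2 Hc HK K0.
  assert (D : forall x, 0 <= x <= 1 ->
     is_derive (fun y => y * (H y + K * (3 - y))) x (df x + K * (3 - 2 * x))).
  { intros x Hx. apply (is_derive_ext (fun y => y * H y + K * (3 * y - y ^ 2))).
    { intros t. simpl. ring. }
    apply @is_derive_plus; [now apply D1|]. auto_derive; [trivial|]. ring. }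
  split; [|split; [|split]].
  - intros x Hx. destruct (HK x Hx) as [A _]. nra.
  - intros u w Hu Huw Hw. destruct (MVT_01 _ _ u w D Hu Huw Hw) as [c [Hc1 E]].
    assert (A := HK c ltac:(lra)).
    assert (0 <= (df c + K * (3 - 2 * c)) * (w - u)); [|lra].
    apply Rmult_le_pos; [|lra]. nra.
  - apply (concave01_of_derive _ _ D). intros x y Hx Hxy Hy.
    destruct (MVT_01 df ddf x y D2 Hx Hxy Hy) as [c [Hc1 E]].
    assert (A := HK c ltac:(lra)).
    assert (ddf c * (y - x) <= K * (y - x)) by (apply Rmult_le_compat_r; lra).
    assert (K * (y - x) >= 0) by nra. lra.
  - intros x Hx. apply @continuous_plus; [now apply Hc|].
    apply ex_derive_continuousR. auto_derive. trivial.
Qed.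

Lemma affine_in_cone (K : R) : 0 <= K -> in_cone (fun x => K * (3 - x)).
Proof.
  intros HK.
  assert (A : in_cone (fun x => 0 + K * (3 - x))).
  { apply (smooth_in_cone (fun _ => 0) (fun _ => 0) (fun _ => 0)); auto.
    - intros x _. auto_derive; [trivial|ring].
    - intros x _. auto_derive; [trivial|ring].
    - intros x _. apply continuous_const.
    - intros x _. lra. }
  destruct A as [A1 [A2 [A3 A4]]]. split; [|split; [|split]].
  - intros x Hx. rewrite <- Rplus_0_l. now apply A1.
  - intros u w Hu Hw Huw. assert (B := A2 u w Hu Hw Huw). simpl in B. now rewrite !Rplus_0_l in B.
  - intros u w l Hu Hw Hl. assert (B := A3 u w l Hu Hw Hl). simpl in B. now rewrite !Rplus_0_l in B.
  - intros x Hx. apply ex_derive_continuousR. auto_derive. trivial.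
Qed.

(* Adding a multiple of [3 - x] moves any C^2 function into the cone. *)
Lemma smooth_mixes (H df ddf : R -> R) :
  (forall x, 0 <= x <= 1 -> is_derive (fun y => y * H y) x (df x)) ->
  (forall x, 0 <= x <= 1 -> is_derive df x (ddf x)) ->
  continuous01 H -> continuous01 ddf -> mixes H.
Proof.
  intros D1 D2 C0 C2.
  assert (C1 : continuous01 df).
  { intros x Hx. apply ex_derive_continuousR. exists (ddf x). now apply D2. }
  destruct (continuous01_bound H C0) as [K0 [P0 B0]].
  destruct (continuous01_bound df C1) as [K1 [P1' B1]].
  destruct (continuous01_bound ddf C2) as [K2 [P2 B2]].
  set (K := K0 + K1 + K2).
  apply (sub_mixes (fun x => H x + K * (3 - x)) (fun x => K * (3 - x))).
  - apply (smooth_in_cone H df ddf); auto; [|unfold K; lra].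
    intros x Hx. assert (X0 := B0 x Hx). assert (X1 := B1 x Hx). assert (X2 := B2 x Hx).
    apply Rabs_le_between in X0, X1, X2. unfold K. lra.
  - apply affine_in_cone. unfold K; lra.
  - intros x _. ring.
Qed.

Lemma mixes_const : mixes (fun _ => 1).
Proof.
  apply (smooth_mixes (fun _ => 1) (fun _ => 1) (fun _ => 0)).
  - intros x _. auto_derive; [trivial|ring].
  - intros x _. auto_derive; [trivial|ring].
  - intros x _. apply continuous_const.
  - intros x _. apply continuous_const.
Qed.

(** * Dominated convergence for triangular sums *)

Fixpoint psum (u : nat -> R) (n : nat) : R :=
  match n with O => 0 | S m => psum u m + u m end.

Lemma psum_ext (u w : nat -> R) (n : nat) :
  (forall m, (m < n)%nat -> u m = w m) -> psum u n = psum w n.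
Proof.
  induction n as [|n IH]; intros H; simpl; [reflexivity|].
  rewrite IH, H; auto with arith.
Qed.

Lemma psum_scal (a : R) (u : nat -> R) (n : nat) : psum (fun m => a * u m) n = a * psum u n.
Proof. induction n as [|n IH]; simpl; [ring|]. rewrite IH. ring. Qed.

Lemma psum_plus (u w : nat -> R) (n : nat) :
  psum (fun m => u m + w m) n = psum u n + psum w n.
Proof. induction n as [|n IH]; simpl; [ring|]. rewrite IH. ring. Qed.

Lemma psum_telescope (u : nat -> R) (n : nat) : psum (fun m => u m - u (S m)) n = u O - u n.
Proof. induction n as [|n IH]; simpl; [ring|]. rewrite IH. ring. Qed.

Lemma psum_lim (u : nat -> nat -> R) (l : nat -> R) (N : nat) :
  (forall m, is_lim_seq (fun n => u n m) (l m)) ->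
  is_lim_seq (fun n => psum (u n) N) (psum l N).
Proof.
  intros H. induction N as [|N IH]; simpl; [apply is_lim_seq_const|].
  now apply is_lim_seq_plus'.
Qed.

Lemma tannery_geometric (u : nat -> nat -> R) (l : nat -> R) (L K r : R) :
  0 <= K -> 0 <= r < 1 ->
  (forall n m, (m < n)%nat -> 0 <= u n m <= K * r ^ m) ->
  (forall m, is_lim_seq (fun n => u n m) (l m)) ->
  is_lim_seq (psum l) L ->
  is_lim_seq (fun n => psum (u n) n) L.
Proof.
  intros HK Hr Hb Hl HL.
  assert (Tail : forall N n, (N <= n)%nat ->
    0 <= psum (u n) n - psum (u n) N <= K * r ^ N / (1 - r)).
  { assert (T : forall n N k, (N + k <= n)%nat ->
      0 <= psum (u n) (N + k) - psum (u n) N <= K * (r ^ N - r ^ (N + k)) / (1 - r)).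
    { intros n N k. induction k as [|k IH]; intros Hk.
      - rewrite Nat.add_0_r. unfold Rminus at 1. rewrite Rplus_opp_r. split; [lra|].
        right. field. lra.
      - rewrite Nat.add_succ_r. simpl psum.
        assert (B := Hb n (N + k)%nat ltac:(lia)). specialize (IH ltac:(lia)).
        replace (K * (r ^ N - r ^ S (N + k)) / (1 - r))
          with (K * (r ^ N - r ^ (N + k)) / (1 - r) + K * r ^ (N + k)) by (simpl; field; lra).
        lra. }
    intros N n H. assert (A := T n N (n - N)%nat ltac:(lia)).
    replace (N + (n - N))%nat with n in A by lia.
    split; [lra|]. apply Rle_trans with (1 := proj2 A).
    unfold Rdiv. apply Rmult_le_compat_r; [left; apply Rinv_0_lt_compat; lra|].
    apply Rmult_le_compat_l; [lra|]. assert (0 <= r ^ n) by (apply pow_le; lra). lra. }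
  assert (T0 : is_lim_seq (fun N => K / (1 - r) * r ^ N) 0).
  { replace (Finite 0) with (Rbar_mult (K / (1 - r)) 0) by (simpl; f_equal; ring).
    apply is_lim_seq_scal_l. apply is_lim_seq_geom. rewrite Rabs_right; lra. }
  apply is_lim_seq_spec. intros eps.
  apply is_lim_seq_spec in T0, HL.
  assert (He : 0 < eps / 3) by (destruct eps; simpl; lra).
  destruct (T0 (mkposreal _ He)) as [N0 H0]. destruct (HL (mkposreal _ He)) as [N1 H1].
  set (N := Nat.max N0 N1).
  specialize (H0 N ltac:(lia)). specialize (H1 N ltac:(lia)). simpl in H0, H1.
  assert (P := psum_lim u l N Hl). apply is_lim_seq_spec in P.
  destruct (P (mkposreal _ He)) as [N2 H2]. simpl in H2.
  exists (Nat.max N N2). intros n Hn. specialize (H2 n ltac:(lia)).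
  assert (A := Tail N n ltac:(lia)).
  replace (K * r ^ N / (1 - r)) with (K / (1 - r) * r ^ N) in A by (field; lra).
  rewrite Rminus_0_r in H0.
  apply Rabs_lt_between in H0, H1, H2. apply Rabs_lt_between. lra.
Qed.

(** * Farey codes *)

(* [true] codes the branch [f11], [false] the branch [f10]. *)
Definition branch (b : bool) (x : R) : R := if b then f11 x else f10 x.

(** Without two consecutive [false], a code is a word in [true] and [false; true], that is, in the
    continued fraction digits 1 and 2. *)
Definition admissible (e : nat -> bool) : Prop := forall n, e n = false -> e (S n) = true.

(** The interval fits admissible codes: [f11] maps [[1/3, 3/4]] onto [[4/7, 3/4]], and [f10] maps
    [[1/2, 3/4]] onto [[1/3, 3/7]]. The two images are [1/7] apart, so [t n] reveals its symbol. *)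
Definition follows (e : nat -> bool) (t : nat -> R) : Prop :=
  forall n, 1 / 3 <= t n <= 3 / 4 /\ t n = branch (e n) (t (S n)).

Lemma branch_diff (b : bool) (x y : R) : 0 <= x -> 0 <= y ->
  Rabs (branch b x - branch b y) = Rabs (x - y) / ((1 + x) * (1 + y)).
Proof.
  intros Hx Hy.
  assert (P : 0 < (1 + x) * (1 + y)) by nra.
  rewrite <- (Rabs_right ((1 + x) * (1 + y))) by lra. unfold Rdiv.
  rewrite <- Rabs_inv, <- Rabs_mult.
  destruct b; unfold branch, f10, f11.
  - rewrite <- Rabs_Ropp. f_equal. field. lra.
  - f_equal. field. lra.
Qed.

Lemma follows_true (e : nat -> bool) (t : nat -> R) (n : nat) :
  follows e t -> e n = true -> 4 / 7 <= t n <= 3 / 4.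
Proof.
  intros H E. split; [|apply (H n)]. destruct (H n) as [_ ->]. rewrite E.
  destruct (H (S n)) as [B _]. unfold branch, f11. apply -> Rle_div_r; lra.
Qed.

Lemma follows_false (e : nat -> bool) (t : nat -> R) (n : nat) :
  follows e t -> e n = false -> 1 / 3 <= t n <= 3 / 7.
Proof.
  intros H E. split; [apply (H n)|]. destruct (H n) as [_ ->]. rewrite E.
  destruct (H (S n)) as [B _]. unfold branch, f10. apply <- Rle_div_l; lra.
Qed.

Lemma follows_T1 (e : nat -> bool) (t : nat -> R) (n : nat) :
  follows e t -> T1 (t n) = t (S n).
Proof.
  intros H. destruct (H (S n)) as [B _]. destruct (H n) as [_ E]. unfold T1.
  destruct (e n) eqn:En.
  - assert (A := follows_true e t n H En). destruct (Rle_dec (t n) (1/2)); [lra|].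
    rewrite E. unfold branch, f11. field. lra.
  - assert (A := follows_false e t n H En). destruct (Rle_dec (t n) (1/2)); [|lra].
    rewrite E. unfold branch, f10. field. lra.
Qed.

Lemma follows_T1iter (e : nat -> bool) (t : nat -> R) (n : nat) :
  follows e t -> T1iter n (t O) = t n.
Proof.
  intros H. induction n as [|n IH]; simpl; [reflexivity|]. rewrite IH. now apply follows_T1 with e.
Qed.

(* Bottom row of the Moebius matrix of the composed inverse branch of depth [n]. *)
Fixpoint row (e : nat -> bool) (n : nat) : R * R :=
  match n with
  | O => (0, 1)
  | S m => if e m then (snd (row e m), fst (row e m) + snd (row e m))
           else (fst (row e m) + snd (row e m), snd (row e m))
  end.

Notation cc e n := (fst (row e n)).
Notation dd e n := (snd (row e n)).

(** A step [false] adds [dd] to [cc], and a step [true] restores [cc <= dd]; since [false] is never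
    repeated, [cc] stays below [2 * dd]. Hence [cc * x + dd] is comparable to [dd] on [[0, 1]]. *)
Lemma row_bounds (e : nat -> bool) (n : nat) : admissible e ->
  0 <= cc e n /\ 1 <= dd e n /\ cc e n <= 2 * dd e n /\ (e n = false -> cc e n <= dd e n).
Proof.
  intros H. induction n as [|n [A [B [C D]]]]; simpl.
  - repeat split; try lra.
  - destruct (e n) eqn:E; simpl.
    + repeat split; lra.
    + specialize (D eq_refl). repeat split; try lra. intros F. rewrite (H n E) in F. discriminate.
Qed.

(** The denominator of the depth-[n] inverse branch at the orbit point: that branch has derivative
    [1 / theta^2] in modulus at [t n]. *)
Definition theta (e : nat -> bool) (t : nat -> R) (n : nat) : R := cc e n * t n + dd e n.

Lemma row_branch (e : nat -> bool) (n : nat) (x : R) : 0 <= x ->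
  cc e n * branch (e n) x + dd e n = (cc e (S n) * x + dd e (S n)) / (1 + x).
Proof.
  intros Hx. simpl. destruct (e n); simpl; unfold f10, f11; field; lra.
Qed.

Lemma row_pos (e : nat -> bool) (n : nat) (x : R) : admissible e -> 0 <= x ->
  0 < dd e n <= cc e n * x + dd e n.
Proof. intros H Hx. assert (A := row_bounds e n H). nra. Qed.

Lemma row_le3 (e : nat -> bool) (n : nat) (x : R) : admissible e -> 0 <= x <= 1 ->
  cc e n * x + dd e n <= 3 * dd e n.
Proof. intros H Hx. assert (A := row_bounds e n H). nra. Qed.

Lemma theta_pos (e : nat -> bool) (t : nat -> R) (n : nat) : admissible e -> follows e t ->
  0 < dd e n <= theta e t n /\ theta e t n <= 3 * dd e n.
Proof.
  intros H Ht. destruct (Ht n) as [B _]. unfold theta. split.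
  - apply row_pos; auto; lra.
  - apply row_le3; auto; lra.
Qed.

Lemma theta_S (e : nat -> bool) (t : nat -> R) (n : nat) : follows e t ->
  theta e t n = theta e t (S n) / (1 + t (S n)).
Proof.
  intros Ht. unfold theta at 1. destruct (Ht n) as [_ ->]. destruct (Ht (S n)) as [B _].
  now rewrite row_branch by lra.
Qed.

(** * Growth of the denominators *)

Definition phi : R := (1 + sqrt 5) / 2.

Lemma phi_sq : phi * phi = phi + 1.
Proof. unfold phi. assert (H := sqrt_sqrt 5 ltac:(lra)). nra. Qed.

Lemma phi_bounds : 8 / 5 < phi < 17 / 10.
Proof. assert (H := phi_sq). assert (0 <= phi) by (unfold phi; assert (H' := sqrt_pos 5); lra). nra. Qed.

(* [(1, phi)] is an eigenvector for the branch [f11], so [size] grows exactly by [phi] along it. *)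
Definition size (e : nat -> bool) (n : nat) : R := cc e n + phi * dd e n.

Lemma size_true (e : nat -> bool) (n : nat) : e n = true -> size e (S n) = phi * size e n.
Proof.
  intros E. unfold size. simpl. rewrite E. simpl.
  replace (phi * (cc e n + phi * dd e n)) with (phi * cc e n + phi * phi * dd e n) by ring.
  rewrite phi_sq. ring.
Qed.

Lemma size_false (e : nat -> bool) (n : nat) : admissible e -> e n = false ->
  size e n <= size e (S n) <= phi * size e n.
Proof.
  intros H E. unfold size. simpl. rewrite E. simpl. assert (P := phi_sq). assert (B := phi_bounds).
  assert (A := row_bounds e n H). split; nra.
Qed.

Lemma size_dd (e : nat -> bool) (n : nat) : admissible e -> dd e n <= size e n <= 4 * dd e n.
Proof.
  intros H. unfold size. assert (B := phi_bounds). assert (A := row_bounds e n H). nra.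
Qed.

Lemma size_le (e : nat -> bool) (n : nat) : admissible e -> size e n <= phi ^ S n.
Proof.
  intros H. assert (B := phi_bounds). induction n as [|n IH].
  - unfold size. simpl. lra.
  - apply Rle_trans with (phi * size e n); [|simpl in *; nra].
    destruct (e n) eqn:E; [right; now apply size_true|now apply size_false].
Qed.

(** A step [true] gains [phi > 8/5 > (5/4)^2], enough to pay for a neighbouring [false], which may
    gain nothing. *)
Lemma dd_exp_growth (e : nat -> bool) (n : nat) : admissible e -> (5 / 4) ^ n <= 4 * dd e n.
Proof.
  intros H. apply Rle_trans with (2 := proj2 (size_dd e n H)).
  assert (B := phi_bounds).
  (* The induction carries a credit: before a [false], the size is already one factor [5/4]
     ahead. *)
  apply (proj1 (A := _) (B := e n = false -> (5 / 4) ^ S n <= size e n)).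
  induction n as [|n [I1 I2]].
  - unfold size. simpl. split; intros; lra.
  - assert (Q : 0 < (5 / 4) ^ n) by (apply pow_lt; lra).
    destruct (e n) eqn:E.
    + rewrite (size_true e n E). simpl. split; intros; nra.
    + split.
      * apply Rle_trans with (size e n); [now apply I2|now apply size_false].
      * intros F. rewrite (H n E) in F. discriminate.
Qed.

(** * Tools for the regular part *)

Lemma mixes_ext (F G : R -> R) : (forall x, 0 <= x <= 1 -> F x = G x) -> mixes F -> mixes G.
Proof.
  intros E H x Hx. rewrite <- (RInt_ext F G).
  - apply is_lim_seq_ext with (2 := H x Hx). intros n. rewrite (P1n_ext F G); auto. lra.
  - intros y Hy. rewrite Rmin_left, Rmax_right in Hy by lra. apply E. lra.
Qed.

(** This is the shape of every [side m]. In the proof [s] is the logarithmic derivative of [E] and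
    [s'] the derivative of [s]. *)
Lemma power_product_mixes (A B K g d p q : R) : 0 <= g -> 0 < d -> 0 < q -> 0 < q + p ->
  mixes (fun x => exp (A * ln (g * x + d) + B * ln (q + p * x) + K)).
Proof.
  intros Hg Hd Hq Hp.
  assert (P : forall x, 0 <= x <= 1 -> 0 < g * x + d /\ 0 < q + p * x)
    by (intros; split; [nra|destruct (Rle_dec 0 p); nra]).
  set (E := fun x => exp (A * ln (g * x + d) + B * ln (q + p * x) + K)).
  set (s := fun x => A * g / (g * x + d) + B * p / (q + p * x)).
  set (s' := fun x => - A * g ^ 2 / (g * x + d) ^ 2 - B * p ^ 2 / (q + p * x) ^ 2).
  apply (smooth_mixes E (fun x => E x + x * (E x * s x))
           (fun x => 2 * (E x * s x) + x * (E x * (s x ^ 2 + s' x)))).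
  - intros x Hx. destruct (P x Hx). unfold E, s. auto_derive; [auto|]. field. lra.
  - intros x Hx. destruct (P x Hx). unfold E, s, s'. auto_derive; [repeat split; auto; lra|].
    field. lra.
  - intros x Hx. destruct (P x Hx). apply ex_derive_continuousR. unfold E. auto_derive. auto.
  - intros x Hx. destruct (P x Hx). apply ex_derive_continuousR. unfold E, s, s'.
    auto_derive. repeat split; auto; apply Rgt_not_eq; nra.
Qed.

Lemma ln_lim_plus (u : nat -> R) (l : R) (k : nat) :
  is_lim_seq (fun n => ln (INR n) * u n) l -> is_lim_seq (fun n => ln (INR (n + k)) * u n) l.
Proof.
  intros H. induction k as [|k IH].
  - apply is_lim_seq_ext with (2 := H). intros n. now rewrite Nat.add_0_r.
  - assert (R0 := proj1 (is_lim_seq_incr_n _ k _) ln_nat_ratio). cbv beta in R0.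
    apply is_lim_seq_ext_loc with
      (fun n => / (ln (INR (n + k)) / ln (INR (S (n + k)))) * (ln (INR (n + k)) * u n)).
    + exists 2%nat. intros n Hn. rewrite Nat.add_succ_r.
      destruct (ln_nat_pos (S (n + k)) ltac:(lia)). destruct (ln_nat_pos (n + k) ltac:(lia)).
      field. lra.
    + replace (Finite l) with (Finite (/ 1 * l)) by (f_equal; field).
      apply is_lim_seq_mult'; [|exact IH].
      replace (Finite (/ 1)) with (Rbar_inv 1) by reflexivity.
      apply is_lim_seq_inv; [exact R0|]. intros E. injection E. lra.
Qed.

Lemma exp_nondecr (x y : R) : x <= y -> exp x <= exp y.
Proof. intros [H| ->]; [left; now apply exp_increasing|lra]. Qed.

Lemma exp_INR_mult (n : nat) (y : R) : exp (INR n * y) = exp y ^ n.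
Proof.
  induction n as [|n IH]; [simpl; now rewrite Rmult_0_l, exp_0|].
  rewrite S_INR, Rmult_plus_distr_r, Rmult_1_l, exp_plus, IH. simpl. ring.
Qed.

(** Bernoulli's inequality for [1 + h = 1/r] gives [(1 + m h) r^m <= 1]. *)
Lemma linear_geom_bound (r : R) : 0 < r < 1 ->
  exists K, 0 <= K /\ forall m, (1 + 2 * INR m) * r ^ m <= K.
Proof.
  intros Hr. set (h := / r - 1).
  assert (Hh : 0 < h).
  { unfold h. apply Rlt_0_minus. rewrite <- Rinv_1. apply Rinv_lt_contravar; lra. }
  assert (Hi : 0 < / h) by now apply Rinv_0_lt_compat.
  exists (1 + 2 * / h). split; [lra|]. intros m.
  assert (B : (1 + INR m * h) * r ^ m <= 1).
  { assert (Q : 0 < r ^ m) by (apply pow_lt; lra).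
    assert (Be := poly m h Hh).
    replace (1 + h) with (/ r) in Be by (unfold h; ring). rewrite pow_inv in Be.
    apply Rle_trans with (/ r ^ m * r ^ m); [apply Rmult_le_compat_r; lra|].
    right. field. lra. }
  assert (Q : 0 <= r ^ m) by (apply pow_le; lra). assert (Pm := pos_INR m).
  apply Rle_trans with ((1 + 2 * / h) * ((1 + INR m * h) * r ^ m)); [|nra].
  rewrite <- Rmult_assoc. apply Rmult_le_compat_r; [exact Q|].
  replace ((1 + 2 * / h) * (1 + INR m * h)) with (1 + INR m * h + 2 * / h + 2 * INR m)
    by (field; lra). nra.
Qed.

Lemma ln_dd (e : nat -> bool) (n : nat) : admissible e ->
  INR n * ln (5 / 4) - ln 4 <= ln (dd e n).
Proof.
  intros He. assert (A := dd_exp_growth e n He). assert (B := row_bounds e n He).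
  apply ln_le in A; [|apply pow_lt; lra]. rewrite ln_mult in A by lra.
  rewrite ln_pow in A by lra. lra.
Qed.

Lemma P1n_one_bound (x : R) : 0 < x <= 1 ->
  exists K, 0 <= K /\ forall n, ln (INR (n + 2)) * P1n n (fun _ => 1) x <= K.
Proof.
  intros Hx. assert (L := ln_lim_plus _ _ 2 (mixes_const x Hx)).
  destruct (maj_by_pos (fun n => ln (INR (n + 2)) * P1n n (fun _ => 1) x)) as [K [HK B]].
  - exists (RInt (fun _ => 1) 0 1 / x). now apply is_lim_seq_Reals.
  - exists K. split; [lra|]. intros n. apply Rle_trans with (2 := B n). apply Rle_abs.
Qed.

Lemma ln_nonneg (y : R) : 1 <= y -> 0 <= ln y.
Proof. intros H. rewrite <- ln_1. apply ln_le; lra. Qed.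

Lemma ln_nonpos (y : R) : 0 < y <= 1 -> ln y <= 0.
Proof. intros H. rewrite <- ln_1. apply ln_le; lra. Qed.

(** * Splitting off the branch through the singularity *)

Section Split.
Context (e : nat -> bool) (t : nat -> R) (al : R).
Context (He : admissible e) (Ht : follows e t) (Hal : 0 < al < 1).

(** The term of the [n]-th transfer operator that belongs to the inverse branch taking [t n] back to
    [t 0]. *)
Fixpoint sing (n : nat) (x : R) : R :=
  match n with
  | O => v (t O) al x
  | S m => sing m (branch (e m) x) / (1 + x) ^ 2
  end.

Definition side (m : nat) (x : R) : R := sing m (branch (negb (e m)) x) / (1 + x) ^ 2.

(** At each depth [m] one branch continues towards the singularity; its sibling turns [sing m] into
    [side m], on which the full operator acts for the remaining [n - S m] steps. *)
Lemma P1n_split (n : nat) (x : R) :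
  P1n n (v (t O) al) x = sing n x + psum (fun m => P1n (n - S m) (side m) x) n.
Proof.
  revert x. induction n as [|n IH]; intros x; [simpl; ring|].
  simpl P1n. rewrite P1_eq, !IH. simpl psum. rewrite Nat.sub_diag. simpl P1n.
  rewrite (psum_ext (fun m => P1n (n - m) (side m) x)
    (fun m => / (1 + x) ^ 2 * (P1n (n - S m) (side m) (f10 x) + P1n (n - S m) (side m) (f11 x)))).
  - rewrite psum_scal, psum_plus.
    change (side n x) with (sing n (branch (negb (e n)) x) / (1 + x) ^ 2). simpl sing.
    destruct (e n); simpl; unfold Rdiv; ring.
  - intros m Hm. replace (n - m)%nat with (S (n - S m)) by lia. simpl P1n. rewrite P1_eq.
    unfold Rdiv. ring.
Qed.

(** If [f] is the branch of depth [n], then [|f'(x)| = (cc x + dd)^(-2)] and [|f(x) - t 0| = |x - t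
    n| / ((cc x + dd) theta)]. The formula is [|f'(x)| |f(x) - t 0|^(-al)]. *)
Definition sing_closed (n : nat) (x : R) : R :=
  exp ((al - 2) * ln (cc e n * x + dd e n) + al * ln (theta e t n) - al * ln (Rabs (x - t n))).

Lemma ln_diff_branch (n : nat) (x : R) : 0 <= x -> x <> t (S n) ->
  branch (e n) x <> t n /\
  ln (Rabs (branch (e n) x - t n)) = ln (Rabs (x - t (S n))) - ln (1 + x) - ln (1 + t (S n)).
Proof.
  intros Hx Hn. destruct (Ht n) as [_ E]. destruct (Ht (S n)) as [B _].
  assert (D := branch_diff (e n) x (t (S n)) Hx ltac:(lra)). rewrite <- E in D.
  assert (P : 0 < Rabs (x - t (S n))) by (apply Rabs_pos_lt; lra).
  assert (Q : 0 < (1 + x) * (1 + t (S n))) by nra.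
  split.
  - intros F. rewrite F, Rminus_diag, Rabs_R0 in D.
    assert (0 < Rabs (x - t (S n)) / ((1 + x) * (1 + t (S n)))); [|lra].
    now apply Rdiv_lt_0_compat.
  - rewrite D, ln_div, ln_mult by lra. ring.
Qed.

Lemma ln_theta (n : nat) : ln (theta e t n) = ln (theta e t (S n)) - ln (1 + t (S n)).
Proof.
  rewrite theta_S by exact Ht. destruct (Ht (S n)) as [B _].
  assert (P := theta_pos e t (S n) He Ht). apply ln_div; lra.
Qed.

Lemma ln_row (n : nat) (x : R) : 0 <= x ->
  ln (cc e n * branch (e n) x + dd e n) = ln (cc e (S n) * x + dd e (S n)) - ln (1 + x).
Proof.
  intros Hx. rewrite row_branch by exact Hx. assert (P := row_pos e (S n) x He Hx).
  apply ln_div; lra.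
Qed.

Lemma inv_sq_exp (x : R) : 0 <= x -> / (1 + x) ^ 2 = exp (- 2 * ln (1 + x)).
Proof.
  intros Hx. replace (- 2 * ln (1 + x)) with (- ln ((1 + x) ^ 2)).
  - rewrite exp_Ropp, exp_ln; [reflexivity|apply pow_lt; lra].
  - simpl. rewrite Rmult_1_r, ln_mult by lra. ring.
Qed.

Lemma branch_nonneg (b : bool) (x : R) : 0 <= x -> 0 <= branch b x.
Proof.
  intros Hx. destruct b; simpl.
  - unfold f11. apply Rmult_le_pos; [lra|]. left. apply Rinv_0_lt_compat. lra.
  - now apply f10_bounds.
Qed.

Lemma sing_eq (n : nat) (x : R) : 0 <= x -> x <> t n -> sing n x = sing_closed n x.
Proof.
  revert x. induction n as [|n IH]; intros x Hx Hn.
  - simpl. unfold sing_closed, v, Rpower, theta. simpl.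
    rewrite !Rmult_0_l, !Rplus_0_l, ln_1, Rabs_minus_sym. f_equal. ring.
  - cbn [sing]. destruct (ln_diff_branch n x Hx Hn) as [D1 D2].
    rewrite IH by auto using branch_nonneg. unfold sing_closed, Rdiv.
    rewrite inv_sq_exp, <- exp_plus by exact Hx. f_equal.
    rewrite D2, ln_theta, ln_row by exact Hx. ring.
Qed.

(* Parameters of [side m]: it is a product of powers of [sg * x + sd] and [sq + sp * x]. *)
Definition sg (m : nat) : R := if e m then cc e m + dd e m else dd e m.
Definition sd (m : nat) : R := if e m then dd e m else cc e m + dd e m.
Definition sp (m : nat) : R := if e m then t m - 1 else - t m.
Definition sq (m : nat) : R := if e m then t m else 1 - t m.

(** By the symbol of [t m], one of [2 t m - 1] and [1 - 2 t m] is at least [1/7]; this keeps the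
    sibling image, which ends at [1/2], away from [t m]. The last identity is a determinant, the
    numerator in the logarithmic derivative of the quotient of the two affine factors. *)
Lemma side_params (m : nat) :
  0 <= sg m /\ 1 <= dd e m <= sd m /\ 1 / 7 <= sq m /\ 1 / 7 <= sq m + sp m /\
  sp m * sd m - sq m * sg m = - theta e t m.
Proof.
  assert (A := row_bounds e m He). unfold sg, sd, sp, sq, theta.
  destruct (e m) eqn:E.
  - assert (B := follows_true e t m Ht E). repeat split; try lra.
  - assert (B := follows_false e t m Ht E). repeat split; try lra.
Qed.

Lemma side_pos (m : nat) (x : R) : 0 <= x <= 1 ->
  dd e m <= sg m * x + sd m /\ 1 / 7 <= sq m + sp m * x.
Proof. intros Hx. assert (A := side_params m). split; nra. Qed.

Definition side_closed (m : nat) (x : R) : R :=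
  exp ((al - 2) * ln (sg m * x + sd m) + (- al) * ln (sq m + sp m * x) + al * ln (theta e t m)).

Lemma side_branch (m : nat) (x : R) : 0 <= x <= 1 ->
  cc e m * branch (negb (e m)) x + dd e m = (sg m * x + sd m) / (1 + x) /\
  Rabs (branch (negb (e m)) x - t m) = (sq m + sp m * x) / (1 + x).
Proof.
  intros Hx. assert (A := side_pos m x Hx). assert (B := row_bounds e m He).
  assert (P : 0 < (sq m + sp m * x) / (1 + x)) by (apply Rdiv_lt_0_compat; lra).
  unfold sg, sd, sq, sp in *. destruct (e m); simpl; unfold f10, f11; split; try (field; lra).
  - rewrite Rabs_left1.
    + field. lra.
    + replace (x / (1 + x) - t m) with (- ((t m + (t m - 1) * x) / (1 + x))) by (field; lra). lra.
  - rewrite Rabs_right.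
    + field. lra.
    + replace (1 / (1 + x) - t m) with ((1 - t m + - t m * x) / (1 + x)) by (field; lra). lra.
Qed.

Lemma side_eq (m : nat) (x : R) : 0 <= x <= 1 -> side m x = side_closed m x.
Proof.
  intros Hx. destruct (side_branch m x Hx) as [D1 D2].
  assert (A := side_pos m x Hx). assert (B := row_bounds e m He).
  unfold side. rewrite sing_eq.
  - unfold sing_closed, side_closed, Rdiv.
    rewrite inv_sq_exp, <- exp_plus by lra. f_equal.
    rewrite D1, D2, !ln_div by lra. ring.
  - apply branch_nonneg. lra.
  - intros F. rewrite F, Rminus_diag, Rabs_R0 in D2.
    assert (0 < (sq m + sp m * x) / (1 + x)) by (apply Rdiv_lt_0_compat; lra). lra.
Qed.

Lemma side_mixes (m : nat) : mixes (side m).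
Proof.
  assert (A := side_params m).
  apply mixes_ext with (side_closed m).
  - intros x Hx. symmetry. now apply side_eq.
  - apply power_product_mixes; lra.
Qed.

(* [prim n] is, up to a sign that changes at [t n], an antiderivative of [sing n]. *)
Definition prim (n : nat) (x : R) : R :=
  exp ((1 - al) * (ln (Rabs (x - t n)) - ln (cc e n * x + dd e n) - ln (theta e t n))) / (1 - al).

(* The integral of [sing n] over [0, 1]. *)
Definition mass (n : nat) : R := prim n 0 + prim n 1.

Lemma prim_branch (n : nat) (x : R) : 0 <= x -> x <> t (S n) ->
  prim (S n) x = prim n (branch (e n) x).
Proof.
  intros Hx Hn. destruct (ln_diff_branch n x Hx Hn) as [_ D].
  unfold prim. rewrite D, (ln_row n), (ln_theta n) by exact Hx. f_equal. f_equal. ring.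
Qed.

(** What [sing m] loses in passing to [sing (S m)] is carried by [side m]. As [sing] is unbounded,
    this is checked on antiderivatives: both sides become [prim m] at an endpoint of [[0, 1]] minus
    [prim m] at [1/2]. *)
Lemma RInt_side (m : nat) : RInt (side m) 0 1 = mass m - mass (S m).
Proof.
  assert (A := side_params m). assert (T := theta_pos e t m He Ht).
  set (G := fun x => exp ((1 - al) * (ln (sq m + sp m * x) - ln (sg m * x + sd m)
                       - ln (theta e t m))) / (1 - al)).
  assert (HG : forall x, 0 <= x <= 1 -> prim m (branch (negb (e m)) x) = G x).
  { intros x Hx. destruct (side_branch m x Hx) as [D1 D2]. assert (P := side_pos m x Hx).
    unfold prim, G. rewrite D1, D2, !ln_div by lra. f_equal. f_equal. ring. }
  assert (I : is_RInt (side_closed m) 0 1 (minus (- G 1) (- G 0))).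
  { apply (is_RInt_derive (fun x => - G x)); rewrite Rmin_left, Rmax_right by lra.
    - intros x Hx. assert (P := side_pos m x Hx). unfold G.
      auto_derive; [repeat split; lra|].
      replace (side_closed m x) with
        (exp ((1 - al) * (ln (sq m + sp m * x) - ln (sg m * x + sd m) - ln (theta e t m)))
         * (theta e t m / ((sq m + sp m * x) * (sg m * x + sd m)))).
      + set (X := exp _).
        replace (theta e t m) with (sq m * sg m - sp m * sd m) by lra.
        field. lra.
      + replace (theta e t m / ((sq m + sp m * x) * (sg m * x + sd m))) with
          (exp (ln (theta e t m) - ln (sq m + sp m * x) - ln (sg m * x + sd m))).
        * unfold side_closed. rewrite <- exp_plus. f_equal. ring.
        * rewrite <- (exp_ln (theta e t m / _)).
          -- f_equal. rewrite ln_div, ln_mult; try lra. apply Rmult_lt_0_compat; lra.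
          -- apply Rdiv_lt_0_compat; [lra|]. apply Rmult_lt_0_compat; lra.
    - intros x Hx. assert (P := side_pos m x Hx). apply ex_derive_continuousR.
      unfold side_closed. auto_derive. repeat split; lra. }
  rewrite (RInt_ext (side m) (side_closed m)).
  2:{ intros x Hx. rewrite Rmin_left, Rmax_right in Hx by lra. apply side_eq. lra. }
  rewrite (is_RInt_unique _ _ _ _ I). unfold minus, plus, opp; simpl.
  rewrite <- !HG by lra. unfold mass. destruct (Ht (S m)) as [B _].
  rewrite !prim_branch by lra.
  assert (E0 : f10 0 = 0) by (unfold f10; field). assert (E1 : f10 1 = 1 / 2) by (unfold f10; field).
  assert (E2 : f11 0 = 1) by (unfold f11; field). assert (E3 : f11 1 = 1 / 2) by (unfold f11; field).
  destruct (e m); simpl; rewrite E0, E1, E2, E3; ring.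
Qed.

Lemma prim_bound (n : nat) (x : R) : 0 <= x <= 1 -> x <> t n ->
  0 <= prim n x <= exp ((2 - 2 * al) * ln 4) / (1 - al) * exp (- (2 - 2 * al) * ln (5 / 4)) ^ n.
Proof.
  intros Hx Hn. unfold prim.
  assert (Pi : 0 < / (1 - al)) by (apply Rinv_0_lt_compat; lra).
  split; [apply Rmult_le_pos; [left; apply exp_pos|lra]|].
  rewrite <- exp_INR_mult. replace (exp ((2 - 2 * al) * ln 4) / (1 - al) * exp (INR n * (- (2 - 2 * al) * ln (5 / 4))))
    with (exp ((2 - 2 * al) * ln 4) * exp (INR n * (- (2 - 2 * al) * ln (5 / 4))) / (1 - al))
    by (field; lra).
  apply Rmult_le_compat_r; [lra|]. rewrite <- exp_plus. apply exp_nondecr.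
  assert (T := theta_pos e t n He Ht). assert (Rw := row_pos e n x He (proj1 Hx)).
  assert (L := ln_dd e n He). destruct (Ht n) as [B _].
  assert (L1 : ln (dd e n) <= ln (theta e t n)) by (apply ln_le; lra).
  assert (L2 : ln (dd e n) <= ln (cc e n * x + dd e n)) by (apply ln_le; lra).
  assert (L3 : ln (Rabs (x - t n)) <= 0).
  { apply ln_nonpos. split; [apply Rabs_pos_lt; lra|]. apply Rabs_le. lra. }
  apply Rle_trans with ((1 - al) * (- 2 * (INR n * ln (5 / 4) - ln 4))); [|right; ring].
  apply Rmult_le_compat_l; lra.
Qed.

Lemma contraction_rate : 0 < exp (- (1 - al) * ln (5 / 4)) < 1.
Proof.
  split; [apply exp_pos|]. apply Rlt_le_trans with (exp 0); [apply exp_increasing|rewrite exp_0; lra].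
  assert (0 < ln (5 / 4)) by (rewrite <- ln_1; apply ln_increasing; lra). nra.
Qed.

Lemma rate_sq : exp (- (2 - 2 * al) * ln (5 / 4)) = exp (- (1 - al) * ln (5 / 4)) ^ 2.
Proof. simpl. rewrite Rmult_1_r, <- exp_plus. f_equal. ring. Qed.

Lemma mass_lim : is_lim_seq mass 0.
Proof.
  set (K := exp ((2 - 2 * al) * ln 4) / (1 - al)).
  set (q := exp (- (2 - 2 * al) * ln (5 / 4))).
  assert (Hq : 0 < q < 1) by (unfold q; rewrite rate_sq; assert (A := contraction_rate); nra).
  apply is_lim_seq_le_le with (fun _ => 0) (fun n => 2 * K * q ^ n).
  - intros n. unfold mass. destruct (Ht n) as [B _].
    assert (A0 := prim_bound n 0 ltac:(lra) ltac:(lra)).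
    assert (A1 := prim_bound n 1 ltac:(lra) ltac:(lra)). fold q K in A0, A1. lra.
  - apply is_lim_seq_const.
  - replace (Finite 0) with (Rbar_mult (2 * K) 0) by (simpl; f_equal; ring).
    apply is_lim_seq_scal_l. apply is_lim_seq_geom. rewrite Rabs_right; lra.
Qed.

(** The constant 21 is [3 * 7], from [theta <= 3 * dd] and the distance factor [1/7]. *)
Lemma side_bound (m : nat) (x : R) : 0 <= x <= 1 ->
  0 <= side m x <= exp ((2 - 2 * al) * ln 4 + al * ln 21) * exp (- (2 - 2 * al) * ln (5 / 4)) ^ m.
Proof.
  intros Hx. rewrite side_eq by exact Hx. unfold side_closed.
  split; [left; apply exp_pos|].
  rewrite <- exp_INR_mult, <- exp_plus. apply exp_nondecr.
  assert (T := theta_pos e t m He Ht). assert (P := side_pos m x Hx).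
  assert (L := ln_dd e m He).
  assert (L1 : ln (theta e t m) <= ln 3 + ln (dd e m)).
  { rewrite <- ln_mult by lra. apply ln_le; lra. }
  assert (L2 : ln (dd e m) <= ln (sg m * x + sd m)) by (apply ln_le; lra).
  assert (L3 : - ln 7 <= ln (sq m + sp m * x)).
  { rewrite <- ln_Rinv by lra. apply ln_le; lra. }
  replace 21 with (3 * 7) by ring. rewrite ln_mult by lra.
  assert ((2 - al) * ln (dd e m) <= (2 - al) * ln (sg m * x + sd m))
    by (apply Rmult_le_compat_l; lra).
  assert (al * - ln 7 <= al * ln (sq m + sp m * x)) by (apply Rmult_le_compat_l; lra).
  assert (al * ln (theta e t m) <= al * (ln 3 + ln (dd e m))) by (apply Rmult_le_compat_l; lra).
  assert ((2 - 2 * al) * (INR m * ln (5 / 4) - ln 4) <= (2 - 2 * al) * ln (dd e m))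
    by (apply Rmult_le_compat_l; lra).
  lra.
Qed.

(** Dominated convergence in [m]: the [m]-th term tends to the integral of [side m] over [x], and
    these integrals telescope to [mass 0]. The decay in [side_bound] is [r^(2m)]: one factor [r^m]
    absorbs the cost of replacing [ln n] by [ln (k + 2)], the other is the summable majorant. *)
Lemma regular_part_lim (x : R) : 0 < x <= 1 ->
  is_lim_seq (fun n => ln (INR n) * psum (fun m => P1n (n - S m) (side m) x) n) (mass O / x).
Proof.
  intros Hx.
  apply is_lim_seq_ext with (fun n => psum (fun m => ln (INR n) * P1n (n - S m) (side m) x) n).
  { intros n. apply psum_scal. }
  destruct (P1n_one_bound x Hx) as [K1 [HK1 B1]].
  set (K2 := exp ((2 - 2 * al) * ln 4 + al * ln 21)).
  assert (HK2 : 0 < K2) by apply exp_pos.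
  set (r := exp (- (1 - al) * ln (5 / 4))). assert (Hr := contraction_rate). fold r in Hr.
  destruct (linear_geom_bound r Hr) as [K3 [HK3 B3]].
  apply (tannery_geometric (fun n m => ln (INR n) * P1n (n - S m) (side m) x)
           (fun m => (mass m - mass (S m)) / x) _ (K1 * K2 * K3) r).
  - repeat apply Rmult_le_pos; lra.
  - lra.
  - intros n m Hnm.
    assert (Ln : 0 <= ln (INR n)) by (apply ln_nonneg; apply (le_INR 1); lia).
    split.
    + apply Rmult_le_pos; [exact Ln|]. apply P1n_nonneg; [|lra]. intros y Hy. now apply side_bound.
    + set (k := (n - S m)%nat).
      assert (A : P1n k (side m) x <= K2 * (r ^ 2) ^ m * P1n k (fun _ => 1) x).
      { apply Rle_trans with (P1n k (fun y => K2 * (r ^ 2) ^ m * 1 + 0 * 1) x).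
        - apply P1n_le; [|lra]. intros y Hy. destruct (side_bound m y Hy) as [_ A].
          rewrite rate_sq in A. fold r K2 in A. lra.
        - rewrite P1n_comb. lra. }
      assert (N1 : 0 <= P1n k (fun _ => 1) x) by (apply P1n_nonneg; intros; lra).
      destruct (ln_nat_pos (k + 2) ltac:(lia)) as [Q1 Q2].
      (* From [n <= (k + 2)(m + 1)]; then [ln (m + 1) <= m <= 2 m ln (k + 2)], because
         [ln 2 > 1/2]. *)
      assert (L : ln (INR n) <= ln (INR (k + 2)) * (1 + 2 * INR m)).
      { assert (ln (INR n) <= ln (INR (k + 2)) + ln (INR (m + 1))).
        { rewrite <- ln_mult; [|apply lt_0_INR; lia|apply lt_0_INR; lia].
          rewrite <- mult_INR. apply ln_le; [apply lt_0_INR; lia|]. apply le_INR. nia. }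
        assert (ln (INR (m + 1)) <= INR m).
        { assert (X := exp_ineq1_le (INR m)). rewrite plus_INR. simpl (INR 1).
          rewrite <- (ln_exp (INR m)) at 2. apply ln_le; [|lra].
          assert (Y := pos_INR m). lra. }
        assert (Y := pos_INR m). assert (Z := ln_lt_2). nra. }
      apply Rle_trans with (ln (INR (k + 2)) * (1 + 2 * INR m)
                            * (K2 * (r ^ 2) ^ m * P1n k (fun _ => 1) x)).
      { apply Rmult_le_compat; auto. apply P1n_nonneg; [|lra]. intros y Hy. now apply side_bound. }
      assert (Pr : 0 <= r ^ m) by (apply pow_le; lra).
      replace ((r ^ 2) ^ m) with (r ^ m * r ^ m)
        by (rewrite <- Rpow_mult_distr; f_equal; ring).
      replace (_ * _) with ((ln (INR (k + 2)) * P1n k (fun _ => 1) x) * K2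
                            * ((1 + 2 * INR m) * r ^ m) * r ^ m) by ring.
      apply Rmult_le_compat_r; [exact Pr|].
      assert (Pm := pos_INR m).
      apply Rmult_le_compat; [|apply Rmult_le_pos; lra| |apply B3].
      * repeat apply Rmult_le_pos; lra.
      * apply Rmult_le_compat_r; [lra|apply B1].
  - intros m. apply is_lim_seq_incr_n with (S m).
    rewrite <- RInt_side.
    apply is_lim_seq_ext with (fun n => ln (INR (n + S m)) * P1n n (side m) x).
    { intros n. now rewrite Nat.add_sub. }
    apply ln_lim_plus. now apply side_mixes.
  - apply is_lim_seq_ext with (fun n => / x * (mass O - mass n)).
    { intros n. rewrite <- psum_telescope, <- psum_scal. apply psum_ext. intros; field; lra. }
    replace (Finite (mass O / x)) with (Rbar_mult (/ x) (mass O - 0)).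
    + apply is_lim_seq_scal_l. apply is_lim_seq_minus'; [apply is_lim_seq_const|apply mass_lim].
    + simpl. f_equal. field. lra.
Qed.

End Split.

(** * The integral of the singular function *)

Lemma RInt_power_left (tau al a : R) : 0 < al < 1 -> 0 <= a < tau ->
  is_RInt (v tau al) 0 a ((exp ((1 - al) * ln tau) - exp ((1 - al) * ln (tau - a))) / (1 - al)).
Proof.
  intros Hal Ha.
  apply (is_RInt_ext (fun x => exp (- al * ln (tau - x)))).
  { intros x Hx. rewrite Rmin_left, Rmax_right in Hx by lra.
    unfold v, Rpower. rewrite Rabs_right by lra. reflexivity. }
  replace (_ / _) with (minus (- (exp ((1 - al) * ln (tau - a)) / (1 - al)))
                              (- (exp ((1 - al) * ln (tau - 0)) / (1 - al)))).
  2:{ unfold minus, plus, opp; simpl. rewrite Rminus_0_r. field. lra. }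
  apply (is_RInt_derive (fun x => - (exp ((1 - al) * ln (tau - x)) / (1 - al))));
    rewrite Rmin_left, Rmax_right by lra.
  - intros x Hx. auto_derive; [lra|].
    replace (exp (- al * ln (tau - x))) with (exp ((1 - al) * ln (tau - x)) * / (tau - x)).
    + unfold Rminus. field. lra.
    + rewrite <- (exp_ln (/ (tau - x))) by (apply Rinv_0_lt_compat; lra).
      rewrite ln_Rinv, <- exp_plus by lra. f_equal. ring.
  - intros x Hx. apply ex_derive_continuousR. auto_derive. lra.
Qed.

Lemma RInt_power_right (tau al b : R) : 0 < al < 1 -> tau < b <= 1 ->
  is_RInt (v tau al) b 1 ((exp ((1 - al) * ln (1 - tau)) - exp ((1 - al) * ln (b - tau))) / (1 - al)).
Proof.
  intros Hal Hb.
  apply (is_RInt_ext (fun x => exp (- al * ln (x - tau)))).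
  { intros x Hx. rewrite Rmin_left, Rmax_right in Hx by lra.
    unfold v, Rpower. rewrite Rabs_left by lra. f_equal. f_equal. f_equal. ring. }
  replace (_ / _) with (minus (exp ((1 - al) * ln (1 - tau)) / (1 - al))
                              (exp ((1 - al) * ln (b - tau)) / (1 - al))).
  2:{ unfold minus, plus, opp; simpl. field. lra. }
  apply (is_RInt_derive (fun x => exp ((1 - al) * ln (x - tau)) / (1 - al)));
    rewrite Rmin_left, Rmax_right by lra.
  - intros x Hx. auto_derive; [lra|].
    replace (exp (- al * ln (x - tau))) with (exp ((1 - al) * ln (x - tau)) * / (x - tau)).
    + unfold Rminus. field. lra.
    + rewrite <- (exp_ln (/ (x - tau))) by (apply Rinv_0_lt_compat; lra).
      rewrite ln_Rinv, <- exp_plus by lra. f_equal. ring.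
  - intros x Hx. apply ex_derive_continuousR. auto_derive. lra.
Qed.

Lemma improper_integral_v (tau al : R) : 0 < al < 1 -> 0 < tau < 1 ->
  improper_integral01 (v tau al) tau
    ((exp ((1 - al) * ln tau) + exp ((1 - al) * ln (1 - tau))) / (1 - al)).
Proof.
  intros Hal Ht eps He.
  assert (Q : 0 < eps * (1 - al) / 2) by nra.
  exists (exp (ln (eps * (1 - al) / 2) / (1 - al))). split; [apply exp_pos|].
  intros a b Ha Hb Ha0 Hb1.
  assert (S : forall y, 0 < y < exp (ln (eps * (1 - al) / 2) / (1 - al)) ->
    exp ((1 - al) * ln y) < eps * (1 - al) / 2).
  { intros y Hy. rewrite <- (exp_ln _ Q) at 1. apply exp_increasing.
    assert (L : ln y < ln (eps * (1 - al) / 2) / (1 - al)).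
    { rewrite <- (ln_exp (ln (eps * (1 - al) / 2) / (1 - al))). apply ln_increasing; lra. }
    apply Rlt_le_trans with ((1 - al) * (ln (eps * (1 - al) / 2) / (1 - al))).
    - apply Rmult_lt_compat_l; lra.
    - right. field. lra. }
  assert (I1 := RInt_power_left tau al a Hal ltac:(lra)).
  assert (I2 := RInt_power_right tau al b Hal ltac:(lra)).
  exists (ex_RInt_Reals_0 _ _ _ (ex_intro _ _ I1)), (ex_RInt_Reals_0 _ _ _ (ex_intro _ _ I2)).
  rewrite <- !RInt_Reals, (is_RInt_unique _ _ _ _ I1), (is_RInt_unique _ _ _ _ I2).
  assert (S1 := S _ Ha). assert (S2 := S _ Hb).
  assert (E1 := exp_pos ((1 - al) * ln (tau - a))). assert (E2 := exp_pos ((1 - al) * ln (b - tau))).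
  replace (_ - _) with (- ((exp ((1 - al) * ln (tau - a)) + exp ((1 - al) * ln (b - tau))) / (1 - al)))
    by (field; lra).
  rewrite Rabs_Ropp, Rabs_right.
  - apply <- Rlt_div_l; lra.
  - apply Rle_ge, Rmult_le_pos; [lra|]. left. apply Rinv_0_lt_compat. lra.
Qed.

Lemma mass_0 (e : nat -> bool) (t : nat -> R) (al : R) : 0 < t O < 1 ->
  mass e t al 0 = (exp ((1 - al) * ln (t O)) + exp ((1 - al) * ln (1 - t O))) / (1 - al).
Proof.
  intros H. unfold mass, prim, theta. simpl.
  rewrite !Rmult_0_l, !Rplus_0_l, ln_1, !Rminus_0_r.
  rewrite Rminus_0_l, Rabs_Ropp, !Rabs_right by lra. unfold Rdiv. ring.
Qed.

(** * Points with a prescribed code *)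

Fixpoint approx (e : nat -> bool) (k n : nat) : R :=
  match k with O => 1 / 2 | S k' => branch (e n) (approx e k' (S n)) end.

(** The extra clause is what a step [false] needs: its successor has symbol [true], hence is at
    least [1/2], and [f10 (1/2) = 1/3]. *)
Lemma approx_bounds (e : nat -> bool) (k n : nat) : admissible e ->
  1 / 3 <= approx e k n <= 3 / 4 /\ (e n = true -> 1 / 2 <= approx e k n).
Proof.
  intros H. revert n. induction k as [|k IH]; intros n; simpl; [split; intros; lra|].
  destruct (IH (S n)) as [B C]. destruct (e n) eqn:E; simpl; unfold f10, f11.
  - split; [split|intros _].
    + apply -> Rle_div_r; lra.
    + apply <- Rle_div_l; lra.
    + apply -> Rle_div_r; lra.
  - specialize (C (H n E)). split; [split|discriminate].
    + apply -> Rle_div_r; lra.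
    + apply <- Rle_div_l; lra.
Qed.

(** Both branches contract by [1 / ((1 + x)(1 + y))], at most [(3/4)^2 = 9/16] for arguments above
    [1/3]. *)
Lemma approx_step (e : nat -> bool) (k n : nat) : admissible e ->
  Rabs (approx e (S k) n - approx e k n) <= (9 / 16) ^ k.
Proof.
  intros H. revert n. induction k as [|k IH]; intros n.
  - destruct (approx_bounds e 1 n H) as [B _]. apply Rabs_le. cbn [approx pow] in *. lra.
  - change (approx e (S (S k)) n) with (branch (e n) (approx e (S k) (S n))).
    change (approx e (S k) n) with (branch (e n) (approx e k (S n))).
    destruct (approx_bounds e (S k) (S n) H) as [B1 _].
    destruct (approx_bounds e k (S n) H) as [B2 _].
    rewrite branch_diff by lra. specialize (IH (S n)).
    assert (P := Rabs_pos (approx e (S k) (S n) - approx e k (S n))).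
    apply <- Rle_div_l; [|nra].
    cbn [pow]. assert (0 <= (9 / 16) ^ k) by (apply pow_le; lra).
    assert (16 / 9 <= (1 + approx e (S k) (S n)) * (1 + approx e k (S n))) by nra.
    nra.
Qed.

Definition pt (e : nat -> bool) (n : nat) : R := real (Lim_seq (fun k => approx e k n)).

Lemma pt_lim (e : nat -> bool) (n : nat) : admissible e ->
  is_lim_seq (fun k => approx e k n) (pt e n).
Proof.
  intros H.
  assert (S0 : ex_series (fun k => approx e (S k) n - approx e k n)).
  { apply (ex_series_le (V := R_CompleteNormedModule) _ (fun k => (9 / 16) ^ k)).
    - intros k. now apply approx_step.
    - apply ex_series_geom. rewrite Rabs_right; lra. }
  destruct S0 as [l Hl].
  assert (L : is_lim_seq (fun k => approx e k n) (l + 1 / 2)).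
  { apply is_lim_seq_incr_1.
    apply is_lim_seq_ext with (fun k => sum_n (fun k => approx e (S k) n - approx e k n) k + 1 / 2).
    - intros k. induction k as [|k IH].
      + rewrite sum_O. simpl. ring.
      + rewrite sum_Sn.
        transitivity (sum_n (fun k => approx e (S k) n - approx e k n) k
                      + (approx e (S (S k)) n - approx e (S k) n) + 1 / 2); [reflexivity|].
        rewrite <- IH. ring.
    - apply is_lim_seq_plus'; [exact Hl|apply is_lim_seq_const]. }
  unfold pt. rewrite (is_lim_seq_unique _ _ L). exact L.
Qed.

Lemma pt_follows (e : nat -> bool) : admissible e -> follows e (pt e).
Proof.
  intros H n.
  assert (B : forall m, 1 / 3 <= pt e m <= 3 / 4).
  { intros m. assert (L := pt_lim e m H). split.
    - apply (is_lim_seq_le (fun _ => 1 / 3) (fun k => approx e k m) (1 / 3) (pt e m)); auto;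
        [|apply is_lim_seq_const]. intros k. apply approx_bounds, H.
    - apply (is_lim_seq_le (fun k => approx e k m) (fun _ => 3 / 4) (pt e m) (3 / 4)); auto;
        [|apply is_lim_seq_const]. intros k. apply approx_bounds, H. }
  split; [apply B|].
  assert (L1 := proj1 (is_lim_seq_incr_1 _ _) (pt_lim e n H)).
  assert (L2 : is_lim_seq (fun k => branch (e n) (approx e k (S n))) (branch (e n) (pt e (S n)))).
  { apply (is_lim_seq_continuous (branch (e n)) _ (pt e (S n))); [|now apply pt_lim].
    apply continuity_pt_filterlim. specialize (B (S n)).
    destruct (e n); [apply continuous_f11|apply continuous_f10]; lra. }
  apply is_lim_seq_unique in L1, L2. cbn [approx] in L1. rewrite L1 in L2. now injection L2.
Qed.

(** * Distance of points in terms of the agreement of their codes *)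

(** Both points are images under the same Moebius map of determinant 1 or -1, which divides
    distances by the product of its two denominators. *)
Lemma agree_dist (e chi : nat -> bool) (t xs : nat -> R) (n M : nat) :
  follows e t -> follows chi xs -> admissible chi ->
  (forall i, (i < M)%nat -> e (n + i)%nat = chi i) ->
  Rabs (t n - xs O) =
    Rabs (t (n + M)%nat - xs M) / ((cc chi M * t (n + M)%nat + dd chi M) * theta chi xs M).
Proof.
  intros Ht Hx Hc. induction M as [|M IH]; intros Ha.
  - unfold theta. simpl. rewrite Nat.add_0_r. field.
  - rewrite IH by (intros; apply Ha; lia).
    assert (E : t (n + M)%nat = branch (chi M) (t (n + S M)%nat)).
    { rewrite <- Ha, Nat.add_succ_r by lia. apply Ht. }
    destruct (Hx M) as [_ E2]. destruct (Hx (S M)) as [B2 _].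
    destruct (Ht (n + S M)%nat) as [B1 _].
    rewrite (theta_S chi xs M Hx), E, row_branch by lra. rewrite E2 at 1.
    rewrite branch_diff by lra.
    assert (P1 := row_pos chi (S M) (t (n + S M)%nat) Hc ltac:(lra)).
    assert (P2 := theta_pos chi xs (S M) Hc Hx).
    field. lra.
Qed.

Lemma agree_dist_le (e chi : nat -> bool) (t xs : nat -> R) (n M : nat) :
  follows e t -> follows chi xs -> admissible chi ->
  (forall i, (i < M)%nat -> e (n + i)%nat = chi i) ->
  Rabs (t n - xs O) <= / (dd chi M * dd chi M).
Proof.
  intros Ht Hx Hc Ha. rewrite (agree_dist e chi t xs n M Ht Hx Hc Ha).
  destruct (Hx M) as [B2 _]. destruct (Ht (n + M)%nat) as [B1 _].
  assert (P1 := row_pos chi M (t (n + M)%nat) Hc ltac:(lra)).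
  assert (P2 := theta_pos chi xs M Hc Hx).
  assert (A : Rabs (t (n + M)%nat - xs M) <= 1) by (apply Rabs_le; lra).
  unfold Rdiv. rewrite <- (Rmult_1_l (/ (dd chi M * dd chi M))).
  apply Rmult_le_compat; [apply Rabs_pos| |exact A|].
  - left. apply Rinv_0_lt_compat. apply Rmult_lt_0_compat; lra.
  - apply Rinv_le_contravar; [apply Rmult_lt_0_compat; lra|]. apply Rmult_le_compat; lra.
Qed.

Lemma first_disagreement (e chi : nat -> bool) (n B : nat) :
  (exists i, (i <= B)%nat /\ e (n + i)%nat <> chi i) ->
  exists M, (M <= B)%nat /\ e (n + M)%nat <> chi M /\
    forall i, (i < M)%nat -> e (n + i)%nat = chi i.
Proof.
  intros [i [Hi Hd]]. revert Hi Hd. induction i as [i IH] using (well_founded_induction lt_wf).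
  intros Hi Hd.
  destruct (classic (exists j, (j < i)%nat /\ e (n + j)%nat <> chi j)) as [[j [Hj Dj]]|N].
  - apply (IH j); auto. lia.
  - exists i. repeat split; auto. intros j Hj.
    destruct (Bool.bool_dec (e (n + j)%nat) (chi j)) as [E|E]; [exact E|].
    exfalso. apply N. now exists j.
Qed.

(** At the first disagreement the points lie in images [1/7] apart, and each denominator is at most
    [3 * phi^(S B)]; hence [63 = 7 * 3 * 3]. *)
Lemma disagree_dist (e chi : nat -> bool) (t xs : nat -> R) (n B : nat) :
  follows e t -> follows chi xs -> admissible chi ->
  (exists i, (i <= B)%nat /\ e (n + i)%nat <> chi i) ->
  / (63 * (phi ^ S B * phi ^ S B)) <= Rabs (t n - xs O).
Proof.
  intros Ht Hx Hc H. destruct (first_disagreement e chi n B H) as [M [HM [Hd Ha]]].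
  rewrite (agree_dist e chi t xs n M Ht Hx Hc Ha).
  destruct (Hx M) as [B2 _]. destruct (Ht (n + M)%nat) as [B1 _].
  assert (P1 := row_pos chi M (t (n + M)%nat) Hc ltac:(lra)).
  assert (P1' := row_le3 chi M (t (n + M)%nat) Hc ltac:(lra)).
  assert (P2 := theta_pos chi xs M Hc Hx).
  assert (A : 1 / 7 <= Rabs (t (n + M)%nat - xs M)).
  { destruct (e (n + M)%nat) eqn:E1, (chi M) eqn:E2; try congruence.
    - assert (X := follows_true e t _ Ht E1). assert (Y := follows_false chi xs _ Hx E2).
      rewrite Rabs_right; lra.
    - assert (X := follows_false e t _ Ht E1). assert (Y := follows_true chi xs _ Hx E2).
      rewrite Rabs_left; lra. }
  assert (Ph := phi_bounds).
  assert (D : dd chi M <= phi ^ S B).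
  { apply Rle_trans with (phi ^ S M).
    - apply Rle_trans with (2 := size_le chi M Hc). now apply size_dd.
    - apply Rle_pow; [lra|lia]. }
  replace (/ (63 * (phi ^ S B * phi ^ S B)))
    with (1 / 7 * / (3 * phi ^ S B * (3 * phi ^ S B))) by (field; apply pow_nonzero; lra).
  apply Rmult_le_compat; [lra| |exact A|].
  - left. apply Rinv_0_lt_compat. apply Rmult_lt_0_compat; lra.
  - apply Rinv_le_contravar; [apply Rmult_lt_0_compat; lra|]. apply Rmult_le_compat; lra.
Qed.

(** * Size of the singular term *)

Fixpoint zeros (e : nat -> bool) (n : nat) : nat :=
  match n with O => O | S m => (zeros e m + (if e m then 0 else 1))%nat end.

(** A [true] multiplies the size by [phi], and a [false] does not decrease it, so each [false] costs
    at most one factor [phi] against the golden code. *)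
Lemma size_ge (e : nat -> bool) (n : nat) : admissible e ->
  phi ^ S n <= phi ^ zeros e n * size e n.
Proof.
  intros H. assert (B := phi_bounds). induction n as [|n IH].
  - unfold size. simpl. lra.
  - assert (Pz : 0 < phi ^ zeros e n) by (apply pow_lt; lra).
    cbn [zeros]. destruct (e n) eqn:E.
    + rewrite Nat.add_0_r, size_true by exact E. change (phi ^ S (S n)) with (phi * phi ^ S n). nra.
    + destruct (size_false e n H E) as [S1 _].
      rewrite Nat.add_1_r. change (phi ^ S (S n)) with (phi * phi ^ S n).
      change (phi ^ S (zeros e n)) with (phi * phi ^ zeros e n).
      assert (phi ^ zeros e n * size e n <= phi ^ zeros e n * size e (S n))
        by (apply Rmult_le_compat_l; lra). nra.
Qed.

Lemma ln_phi_pos : 0 < ln phi.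
Proof. assert (B := phi_bounds). rewrite <- ln_1. apply ln_increasing; lra. Qed.

Lemma ln_dd_ge (e : nat -> bool) (n k : nat) : admissible e -> (zeros e n <= k)%nat ->
  (INR n + 1 - INR k) * ln phi - ln 4 <= ln (dd e n).
Proof.
  intros H Hk. assert (B := phi_bounds). assert (A := size_ge e n H).
  assert (S4 := size_dd e n H). assert (Rw := row_bounds e n H).
  assert (Pk : 0 < phi ^ zeros e n) by (apply pow_lt; lra).
  assert (L : ln (phi ^ S n) <= ln (phi ^ zeros e n * (4 * dd e n))).
  { apply ln_le; [apply pow_lt; lra|]. apply Rle_trans with (1 := A).
    apply Rmult_le_compat_l; lra. }
  rewrite !ln_mult, !ln_pow, S_INR in L by lra.
  apply le_INR in Hk. assert (Q := ln_phi_pos). nra.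
Qed.

Lemma ln_dd_le (e : nat -> bool) (n : nat) : admissible e ->
  ln (dd e n) <= (INR n + 1) * ln phi.
Proof.
  intros H. assert (B := phi_bounds). assert (Rw := row_bounds e n H).
  rewrite <- S_INR, <- ln_pow by lra. apply ln_le; [lra|].
  apply Rle_trans with (2 := size_le e n H). now apply size_dd.
Qed.

Section Singular.
Context (e chi : nat -> bool) (t xs : nat -> R) (al : R).
Context (He : admissible e) (Ht : follows e t) (Hc : admissible chi) (Hx : follows chi xs).
Context (Hal : 0 < al < 1).

Lemma sing_upper (n k B : nat) : (zeros e n <= k)%nat ->
  (exists i, (i <= B)%nat /\ e (n + i)%nat <> chi i) ->
  0 <= sing e t al n (xs O) <=
    exp ((2 - 2 * al) * ln 4 + al * ln 189 + 2 * al * ln phi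
         - ln phi * ((2 - 2 * al) * (INR n - INR k) - 2 * al * INR B)).
Proof.
  intros Hk Hd. assert (D := disagree_dist e chi t xs n B Ht Hx Hc Hd).
  assert (Ph := phi_bounds). assert (Q := ln_phi_pos).
  assert (Pp : 0 < phi ^ S B) by (apply pow_lt; lra).
  assert (P0 : 0 < / (63 * (phi ^ S B * phi ^ S B))) by (apply Rinv_0_lt_compat; nra).
  destruct (Hx O) as [B0 _].
  rewrite (sing_eq e t al He Ht Hal n); [|lra|].
  2:{ intros F. rewrite F, Rminus_diag, Rabs_R0 in D. lra. }
  unfold sing_closed. split; [left; apply exp_pos|]. apply exp_nondecr.
  rewrite (Rabs_minus_sym (xs O)).
  assert (L0 := ln_dd_ge e n k He Hk).
  assert (T := theta_pos e t n He Ht). assert (Rw := row_pos e n (xs O) He ltac:(lra)).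
  assert (L1 : ln (theta e t n) <= ln 3 + ln (dd e n)).
  { rewrite <- ln_mult by lra. apply ln_le; lra. }
  assert (L2 : ln (dd e n) <= ln (cc e n * xs O + dd e n)) by (apply ln_le; lra).
  assert (L3 : - (ln 63 + 2 * ((INR B + 1) * ln phi)) <= ln (Rabs (t n - xs O))).
  { apply ln_le in D; [|exact P0]. rewrite ln_Rinv, !ln_mult, !ln_pow, S_INR in D; nra. }
  replace 189 with (3 * 63) by ring. rewrite ln_mult by lra.
  assert ((2 - al) * ln (dd e n) <= (2 - al) * ln (cc e n * xs O + dd e n))
    by (apply Rmult_le_compat_l; lra).
  assert (al * - (ln 63 + 2 * ((INR B + 1) * ln phi)) <= al * ln (Rabs (t n - xs O)))
    by (apply Rmult_le_compat_l; lra).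
  assert (al * ln (theta e t n) <= al * (ln 3 + ln (dd e n))) by (apply Rmult_le_compat_l; lra).
  assert ((2 - 2 * al) * ((INR n + 1 - INR k) * ln phi - ln 4) <= (2 - 2 * al) * ln (dd e n))
    by (apply Rmult_le_compat_l; lra).
  assert (0 <= (2 - 2 * al) * ln phi) by (apply Rmult_le_pos; lra).
  lra.
Qed.

(** Long agreement makes [t n] close to [xs 0]; with at most one [false] in [chi], that distance is
    at most a constant times [phi^(-2M)]. *)
Lemma sing_lower (n M : nat) : (zeros chi M <= 1)%nat -> t n <> xs O ->
  (forall i, (i < M)%nat -> e (n + i)%nat = chi i) ->
  exp (ln phi * (2 * al * INR M - (2 - 2 * al) * (INR n + 1)) - 2 * ln 3 - 2 * ln 4)
    <= sing e t al n (xs O).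
Proof.
  intros Hz Hn Ha. assert (D := agree_dist_le e chi t xs n M Ht Hx Hc Ha).
  destruct (Hx O) as [B0 _].
  rewrite (sing_eq e t al He Ht Hal n) by (try lra; intros F; now apply Hn).
  unfold sing_closed. apply exp_nondecr. rewrite (Rabs_minus_sym (xs O)).
  assert (L0 := ln_dd_le e n He). assert (L0' := ln_dd_ge chi M 1 Hc Hz).
  assert (Rc := row_bounds chi M Hc).
  assert (T := theta_pos e t n He Ht). assert (Rw := row_pos e n (xs O) He ltac:(lra)).
  assert (Rw' := row_le3 e n (xs O) He ltac:(lra)).
  assert (L1 : ln (dd e n) <= ln (theta e t n)) by (apply ln_le; lra).
  assert (L2 : ln (cc e n * xs O + dd e n) <= ln 3 + ln (dd e n)).
  { rewrite <- ln_mult by lra. apply ln_le; lra. }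
  assert (L3 : ln (Rabs (t n - xs O)) <= - (2 * ln (dd chi M))).
  { apply ln_le in D; [|apply Rabs_pos_lt; lra]. rewrite ln_Rinv, ln_mult in D; nra. }
  assert ((2 - al) * ln (cc e n * xs O + dd e n) <= (2 - al) * (ln 3 + ln (dd e n)))
    by (apply Rmult_le_compat_l; lra).
  assert (al * ln (Rabs (t n - xs O)) <= al * - (2 * ln (dd chi M)))
    by (apply Rmult_le_compat_l; lra).
  assert (al * ln (dd e n) <= al * ln (theta e t n)) by (apply Rmult_le_compat_l; lra).
  assert ((2 - 2 * al) * ln (dd e n) <= (2 - 2 * al) * ((INR n + 1) * ln phi))
    by (apply Rmult_le_compat_l; lra).
  simpl (INR 1) in L0'.
  assert (al * ((INR M + 1 - 1) * ln phi - ln 4) <= al * ln (dd chi M))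
    by (apply Rmult_le_compat_l; lra).
  assert (0 < ln 3) by (rewrite <- ln_1; apply ln_increasing; lra).
  assert (0 < ln 4) by (rewrite <- ln_1; apply ln_increasing; lra).
  assert (0 <= al * ln 3) by (apply Rmult_le_pos; lra).
  assert (al * ln 4 <= 1 * ln 4) by (apply Rmult_le_compat_r; lra).
  lra.
Qed.

End Singular.

Lemma linear_exp_decay (K c : R) : 0 < c -> is_lim_seq (fun n => INR n * exp (K - c * INR n)) 0.
Proof.
  intros Hc. set (r := exp (- (c / 2))).
  assert (Hr : 0 < r < 1).
  { split; [apply exp_pos|]. apply Rlt_le_trans with (exp 0); [|rewrite exp_0; lra].
    apply exp_increasing. lra. }
  destruct (linear_geom_bound r Hr) as [M [HM B]].
  apply is_lim_seq_le_le with (fun _ => 0) (fun n => exp K * M * r ^ n).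
  - intros n. assert (P := pos_INR n). split.
    + apply Rmult_le_pos; [exact P|left; apply exp_pos].
    + replace (exp (K - c * INR n)) with (exp K * (r ^ n * r ^ n)).
      2:{ unfold r. rewrite <- !exp_INR_mult, <- !exp_plus. f_equal. field. }
      assert (Q : 0 < r ^ n) by (apply pow_lt; lra). specialize (B n).
      replace (_ * _) with (exp K * (INR n * r ^ n) * r ^ n) by ring.
      apply Rmult_le_compat_r; [lra|]. apply Rmult_le_compat_l; [left; apply exp_pos|]. nra.
  - apply is_lim_seq_const.
  - replace (Finite 0) with (Rbar_mult (exp K * M) 0) by (simpl; f_equal; ring).
    apply is_lim_seq_scal_l. apply is_lim_seq_geom. rewrite Rabs_right; lra.
Qed.

Lemma ln_le_self (n : nat) : ln (INR n) <= INR n.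
Proof.
  destruct n as [|n].
  - simpl. unfold ln. destruct (Rlt_dec 0 0) as [H|H]; [destruct (Rlt_irrefl _ H)|lra].
  - rewrite <- (ln_exp (INR (S n))) at 2. apply ln_le; [apply lt_0_INR; lia|].
    assert (X := exp_ineq1_le (INR (S n))). lra.
Qed.

(** Here [k] bounds the number of [false] symbols and [B] the length of agreement. As [k] is of
    order [sqrt n], losses linear in [k] are beaten by [eta * n], which also beats [ln n]. The
    factor 10 leaves room for the bounds of both sequences. *)
Lemma sing_small (e chi : nat -> bool) (t xs : nat -> R) (al eta c0 : R) :
  admissible e -> follows e t -> admissible chi -> follows chi xs -> 0 < al < 1 -> 0 < eta ->
  forall eps, 0 < eps -> exists N, forall n, (N <= n)%nat -> forall k B,
    (k * k <= 2 * n)%nat -> (zeros e n <= k)%nat ->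
    (exists i, (i <= B)%nat /\ e (n + i)%nat <> chi i) ->
    eta * INR n - 10 * INR k - c0 <= (2 - 2 * al) * (INR n - INR k) - 2 * al * INR B ->
    ln (INR n) * sing e t al n (xs O) < eps.
Proof.
  intros He Ht Hc Hx Hal Heta eps Heps.
  set (K := (2 - 2 * al) * ln 4 + al * ln 189 + 2 * al * ln phi).
  assert (Q := ln_phi_pos).
  assert (L := linear_exp_decay (K + ln phi * (c0 + 100 / eta)) (ln phi * (eta / 2)) ltac:(nra)).
  apply is_lim_seq_spec in L. destruct (L (mkposreal eps Heps)) as [N HN]. simpl in HN.
  exists N. intros n Hn k B Hk Hz Hd Hi. specialize (HN n Hn).
  rewrite Rminus_0_r in HN. apply Rabs_lt_between in HN.
  apply Rle_lt_trans with (2 := proj2 HN).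
  destruct (sing_upper e chi t xs al He Ht Hc Hx Hal n k B Hz Hd) as [S0 S1]. fold K in S1.
  apply Rle_trans with (INR n * sing e t al n (xs O)).
  { apply Rmult_le_compat_r; [exact S0|apply ln_le_self]. }
  apply Rmult_le_compat_l; [apply pos_INR|]. apply Rle_trans with (1 := S1). apply exp_nondecr.
  assert (Hk' : INR k * INR k <= 2 * INR n).
  { apply le_INR in Hk. rewrite !mult_INR in Hk. simpl (INR 2) in Hk. lra. }
  (* AM-GM, with [k^2 <= 2 n] *)
  assert (AG : 10 * INR k <= eta / 2 * INR n + 100 / eta).
  { apply Rle_trans with (eta / 4 * (INR k * INR k) + 100 / eta); [|nra].
    apply Rminus_le_0.
    replace (_ - _) with ((eta * INR k - 20) ^ 2 * / (4 * eta)) by (field; lra).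
    apply Rmult_le_pos; [apply pow2_ge_0|]. left. apply Rinv_0_lt_compat. lra. }
  assert (ln phi * (eta * INR n - (eta / 2 * INR n + 100 / eta) - c0)
          <= ln phi * ((2 - 2 * al) * (INR n - INR k) - 2 * al * INR B)).
  { apply Rmult_le_compat_l; lra. }
  nra.
Qed.

(** * Codes with sparse zeros *)

(** The code is [false] exactly on the range of [z]; searching [k <= n] suffices because the gap
    condition forces [k <= z k]. *)
Definition zcode (z : nat -> nat) (n : nat) : bool :=
  negb (existsb (fun k => Nat.eqb (z k) n) (List.seq 0 (S n))).

(** Codes of the candidate limit points: [None] is [[1,1,...]], and [Some j] has its single digit 2
    after [j] ones. *)
Definition chi (o : option nat) (i : nat) : bool :=
  match o with None => true | Some j => negb (Nat.eqb i j) end.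

Lemma chi_admissible (o : option nat) : admissible (chi o).
Proof.
  intros n. destruct o as [j|]; unfold chi; [|discriminate].
  destruct (Nat.eqb_spec n j); [|discriminate]. subst. intros _.
  destruct (Nat.eqb_spec (S j) j); [lia|reflexivity].
Qed.

Lemma chi_unique_zero (o : option nat) (i j : nat) : chi o i = false -> chi o j = false -> i = j.
Proof.
  destruct o as [k|]; simpl; [|discriminate].
  destruct (Nat.eqb_spec i k), (Nat.eqb_spec j k); simpl; congruence.
Qed.

Lemma zeros_chi (o : option nat) (n : nat) : (zeros (chi o) n <= 1)%nat.
Proof.
  destruct o as [j|].
  - assert (A : (zeros (chi (Some j)) n <= if Nat.ltb j n then 1 else 0)%nat).
    { induction n as [|n IH]; [simpl; lia|]. cbn [zeros chi].
      destruct (Nat.ltb_spec j n), (Nat.ltb_spec j (S n)), (Nat.eqb_spec n j); simpl; lia. }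
    destruct (Nat.ltb j n); lia.
  - induction n as [|n IH]; simpl in *; lia.
Qed.

Lemma agree_close (e ch : nat -> bool) (t xs : nat -> R) (n M : nat) :
  follows e t -> follows ch xs -> admissible ch ->
  (forall i, (i < M)%nat -> e (n + i)%nat = ch i) ->
  Rabs (t n - xs O) <= 16 * (16 / 25) ^ M.
Proof.
  intros Ht Hx Hc Ha. apply Rle_trans with (1 := agree_dist_le e ch t xs n M Ht Hx Hc Ha).
  assert (G := dd_exp_growth ch M Hc). assert (P : 0 < (5 / 4) ^ M) by (apply pow_lt; lra).
  replace (16 * (16 / 25) ^ M) with (/ ((5 / 4) ^ M / 4 * ((5 / 4) ^ M / 4))).
  - apply Rinv_le_contravar; [nra|]. apply Rmult_le_compat; lra.
  - replace (16 / 25) with (/ (5 / 4) * / (5 / 4)) by field.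
    rewrite Rpow_mult_distr, pow_inv. field. lra.
Qed.

Lemma geom_small (eps : R) : 0 < eps -> exists N, forall n, (N <= n)%nat -> 16 * (16 / 25) ^ n < eps.
Proof.
  intros H.
  assert (L : is_lim_seq (fun n => 16 * (16 / 25) ^ n) 0).
  { replace (Finite 0) with (Rbar_mult 16 0) by (simpl; f_equal; ring).
    apply is_lim_seq_scal_l. apply is_lim_seq_geom. rewrite Rabs_right; lra. }
  apply is_lim_seq_spec in L. destruct (L (mkposreal eps H)) as [N HN]. exists N.
  intros n Hn. specialize (HN n Hn). simpl in HN. rewrite Rminus_0_r in HN.
  apply Rabs_lt_between in HN. lra.
Qed.

Section ZCode.
Context (z : nat -> nat).
Context (Hz : forall k, (z k + 2 <= z (S k))%nat).

Lemma z_mono (i j : nat) : (i < j)%nat -> (z i + 2 <= z j)%nat.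
Proof.
  intros H. induction H as [|j H IH]; [apply Hz|]. assert (A := Hz j). lia.
Qed.

Lemma z_ge (k : nat) : (k <= z k)%nat.
Proof. induction k as [|k IH]; [lia|]. assert (A := Hz k). lia. Qed.

Lemma z_lt_inv (i j : nat) : (z i < z j)%nat -> (i < j)%nat.
Proof.
  intros H. destruct (Nat.lt_trichotomy i j) as [L|[L|L]]; [exact L| |].
  - subst. lia.
  - apply z_mono in L. lia.
Qed.

Lemma zcode_false (n : nat) : zcode z n = false <-> exists k, z k = n.
Proof.
  unfold zcode. rewrite Bool.negb_false_iff, existsb_exists. split.
  - intros [k [_ E]]. apply Nat.eqb_eq in E. now exists k.
  - intros [k E]. exists k. split; [|now apply Nat.eqb_eq].
    apply in_seq. assert (A := z_ge k). lia.
Qed.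

Lemma zcode_at (k : nat) : zcode z (z k) = false.
Proof. apply zcode_false. now exists k. Qed.

Lemma zcode_true (n : nat) : (forall k, z k <> n) -> zcode z n = true.
Proof.
  intros H. destruct (zcode z n) eqn:E; [reflexivity|].
  apply zcode_false in E. destruct E as [k E]. now destruct (H k).
Qed.

Lemma zcode_admissible : admissible (zcode z).
Proof.
  intros n E. apply zcode_false in E. destruct E as [k E].
  apply zcode_true. intros j Ej.
  assert (k < j)%nat by (apply z_lt_inv; lia).
  apply z_mono in H. lia.
Qed.

Lemma next_zero (n : nat) : exists k, (n <= z k)%nat /\ forall i, (i < k)%nat -> (z i < n)%nat.
Proof.
  assert (A : forall K, (n <= z K)%nat ->
    exists k, (n <= z k)%nat /\ forall i, (i < k)%nat -> (z i < n)%nat).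
  { induction K as [|K IH]; intros HK; [exists O; split; [exact HK|lia]|].
    destruct (le_lt_dec n (z K)) as [L|L]; [now apply IH|].
    exists (S K). split; [exact HK|]. intros i Hi.
    destruct (Nat.eq_dec i K) as [->|D]; [exact L|].
    assert (B := z_mono i K ltac:(lia)). lia. }
  apply (A n), z_ge.
Qed.

Lemma zeros_zcode (n k : nat) : (n <= z k)%nat -> (zeros (zcode z) n <= k)%nat.
Proof.
  revert k. induction n as [|n IH]; intros k H; simpl; [lia|].
  destruct (zcode z n) eqn:E.
  - specialize (IH k ltac:(lia)). lia.
  - apply zcode_false in E. destruct E as [i E].
    assert (L : (i < k)%nat) by (apply z_lt_inv; lia).
    specialize (IH i ltac:(lia)). lia.
Qed.

Lemma zcode_agree (n k i : nat) : (n <= z k)%nat -> (forall j, (j < k)%nat -> (z j < n)%nat) ->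
  (i < z (S k) - n)%nat -> zcode z (n + i) = chi (Some (z k - n)%nat) i.
Proof.
  intros Hn Hk Hi. simpl. destruct (Nat.eqb_spec i (z k - n)) as [->|D]; simpl.
  - replace (n + (z k - n))%nat with (z k) by lia. apply zcode_at.
  - apply zcode_true. intros j E.
    assert (j < S k)%nat by (apply z_lt_inv; lia).
    destruct (Nat.eq_dec j k) as [->|Dj]; [lia|]. specialize (Hk j ltac:(lia)). lia.
Qed.

Lemma zcode_agree_none (n k i : nat) : (z k < n)%nat ->
  (i < z (S k) - n)%nat -> zcode z (n + i) = chi None i.
Proof.
  intros Hn Hi. simpl. apply zcode_true. intros j E.
  assert (j < S k)%nat by (apply z_lt_inv; lia).
  assert (k < j)%nat by (apply z_lt_inv; lia). lia.
Qed.

(** A window reaching two zeros of the code cannot agree with [chi o], which has at most one. *)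
Lemma zcode_disagree (o : option nat) (n k : nat) : (n <= z k)%nat ->
  exists i, (i <= z (S k) - n)%nat /\ zcode z (n + i) <> chi o i.
Proof.
  intros Hn. assert (A := Hz k).
  destruct (chi o (z k - n)) eqn:E.
  - exists (z k - n)%nat. split; [lia|]. rewrite E.
    replace (n + (z k - n))%nat with (z k) by lia. rewrite zcode_at. discriminate.
  - exists (z (S k) - n)%nat. split; [lia|].
    replace (n + (z (S k) - n))%nat with (z (S k)) by lia. rewrite zcode_at.
    intros F. symmetry in F. assert (G := chi_unique_zero _ _ _ E F). lia.
Qed.

(** The points coded by [Some j] accumulate only at the one coded by [None], so a point different
    from all of them has a positive distance [d] from all. But once the gaps are long, [t l] agrees
    for [G] symbols with the [Some] code of its next zero, and so comes within [d/2] of such a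
    point. *)
Lemma Omega1_zcode (t : nat -> R) (x : R) :
  (forall G, exists K, forall k, (K <= k)%nat -> (z k + G <= z (S k))%nat) ->
  follows (zcode z) t -> Omega1 (t O) x -> exists o, x = pt (chi o) O.
Proof.
  intros Hg Ht HO. apply NNPP. intros Hno.
  assert (Hne : forall o, x <> pt (chi o) O) by (intros o E; apply Hno; now exists o).
  assert (Hf : forall o, follows (chi o) (pt (chi o))) by (intros o; apply pt_follows, chi_admissible).
  assert (Sep : exists d, 0 < d /\ forall j, d <= Rabs (x - pt (chi (Some j)) O)).
  { set (d0 := Rabs (x - pt (chi None) O)).
    assert (Hd0 : 0 < d0) by (apply Rabs_pos_lt; specialize (Hne None); lra).
    destruct (geom_small (d0 / 2) ltac:(lra)) as [J HJ].
    assert (Fin : forall m, exists d, 0 < d /\ forall j, (j < m)%nat ->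
      d <= Rabs (x - pt (chi (Some j)) O)).
    { induction m as [|m [d [Hd IH]]]; [exists 1; split; [lra|lia]|].
      assert (Pm : 0 < Rabs (x - pt (chi (Some m)) O))
        by (apply Rabs_pos_lt; specialize (Hne (Some m)); lra).
      exists (Rmin d (Rabs (x - pt (chi (Some m)) O))). split; [now apply Rmin_pos|].
      intros j Hj. destruct (Nat.eq_dec j m) as [->|D]; [apply Rmin_r|].
      apply Rle_trans with (1 := Rmin_l _ _). apply IH. lia. }
    destruct (Fin J) as [d1 [Hd1 F]].
    exists (Rmin d1 (d0 / 2)). split; [apply Rmin_pos; lra|].
    intros j. destruct (le_lt_dec J j) as [L|L].
    - apply Rle_trans with (1 := Rmin_r _ _).
      assert (A := agree_close (chi (Some j)) (chi None) (pt (chi (Some j))) (pt (chi None)) 0 j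
        (Hf _) (Hf _) (chi_admissible _)).
      assert (B : Rabs (pt (chi (Some j)) O - pt (chi None) O) <= 16 * (16 / 25) ^ j).
      { apply A. intros i Hi. simpl. destruct (Nat.eqb_spec i j); [lia|reflexivity]. }
      specialize (HJ j L).
      assert (T := Rabs_triang (x - pt (chi (Some j)) O) (pt (chi (Some j)) O - pt (chi None) O)).
      replace (x - pt (chi (Some j)) O + (pt (chi (Some j)) O - pt (chi None) O))
        with (x - pt (chi None) O) in T by ring. fold d0 in T. lra.
    - apply Rle_trans with (1 := Rmin_l _ _). now apply F. }
  destruct Sep as [d [Hd Sep]].
  destruct (geom_small (d / 2) ltac:(lra)) as [G HG].
  destruct (Hg G) as [K HK].
  destruct (HO (S (z K)) (d / 2) ltac:(lra)) as [l [Hl Hd2]].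
  rewrite (follows_T1iter (zcode z)) in Hd2 by exact Ht.
  destruct (next_zero l) as [k [Hk1 Hk2]].
  assert (HKk : (K <= k)%nat).
  { destruct (le_lt_dec K k) as [L|L]; [exact L|]. apply z_mono in L. lia. }
  specialize (HK k HKk).
  assert (A := agree_close (zcode z) (chi (Some (z k - l)%nat)) t (pt (chi (Some (z k - l)%nat))) l G
    Ht (Hf _) (chi_admissible _)).
  assert (B : Rabs (t l - pt (chi (Some (z k - l)%nat)) O) <= 16 * (16 / 25) ^ G).
  { apply A. intros i Hi. apply zcode_agree; auto. lia. }
  specialize (HG G (le_n G)). specialize (Sep (z k - l)%nat).
  set (y := pt (chi (Some (z k - l)%nat)) O) in *.
  assert (T := Rabs_triang (x - t l) (t l - y)).
  replace (x - t l + (t l - y)) with (x - y) in T by ring.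
  rewrite Rabs_minus_sym in Hd2. lra.
Qed.

End ZCode.

(** * Continued fractions *)

(* Infinite descent on the sum of numerator and denominator. *)
Lemma follows_irrational (e : nat -> bool) (t : nat -> R) : follows e t -> irrational (t O).
Proof.
  intros Ht [p [q [Hq E]]].
  assert (Desc : forall N n (p q : Z), (0 < p)%Z -> (0 < q)%Z -> (p + q <= Z.of_nat N)%Z ->
    t n * IZR q = IZR p -> False).
  { induction N as [|N IH]; intros n a b Ha Hb Hab Et; [lia|].
    destruct (Ht n) as [B0 E0]. destruct (Ht (S n)) as [B1 _].
    apply IZR_lt in Ha as Ha', Hb as Hb'. simpl in Ha', Hb'.
    assert (Hlt : (a < b)%Z) by (apply lt_IZR; nra).
    destruct (e n); unfold branch, f10, f11 in E0.
    - apply (IH (S n) (b - a)%Z a); try lia. rewrite minus_IZR, <- Et, E0. field. lra.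
    - apply (IH (S n) a (b - a)%Z); try lia. rewrite minus_IZR, <- Et, E0. field. lra. }
  destruct (Ht O) as [B _].
  destruct (Z.lt_trichotomy q 0) as [L|[L|L]]; [|easy|].
  - assert (L' := IZR_lt _ _ L). simpl in L'.
    assert (Et : t O * IZR (- q) = IZR (- p)) by (rewrite !opp_IZR, E; field; lra).
    assert (0 < - p)%Z by (apply lt_IZR; rewrite <- Et, opp_IZR; nra).
    apply (Desc (Z.to_nat (- p + - q)) O (- p)%Z (- q)%Z); try lia. exact Et.
  - assert (L' := IZR_lt _ _ L). simpl in L'.
    assert (Et : t O * IZR q = IZR p) by (rewrite E; field; lra).
    assert (0 < p)%Z by (apply lt_IZR; rewrite <- Et; nra).
    apply (Desc (Z.to_nat (p + q)) O p q); try lia. exact Et.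
Qed.

(* Code position at which the [k]-th continued fraction digit starts: the digit 1 is coded
   by [true], the digit 2 by [false; true]. *)
Fixpoint pos (e : nat -> bool) (k : nat) : nat :=
  match k with O => O | S k' => if e (pos e k') then S (pos e k') else S (S (pos e k')) end.

Lemma inv_follows (e : nat -> bool) (t : nat -> R) (k : nat) :
  admissible e -> follows e t ->
  / t (pos e k) = (if e (pos e k) then 1 else 2) + t (pos e (S k)).
Proof.
  intros He Ht. simpl. set (p := pos e k). destruct (Ht p) as [B0 E0].
  destruct (Ht (S p)) as [B1 E1]. destruct (Ht (S (S p))) as [B2 _].
  destruct (e p) eqn:E.
  - rewrite E0. unfold branch, f11. field. lra.
  - rewrite (He p E) in E1. rewrite E0, E1. unfold branch, f10, f11. field. lra.
Qed.

Lemma cf_follows (e : nat -> bool) (t : nat -> R) (k : nat) :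
  admissible e -> follows e t ->
  cf_rem (t O) k = t (pos e k) /\ cf_entry (t O) k = (if e (pos e k) then 1 else 2)%Z.
Proof.
  intros He Ht.
  assert (Ent : forall k, Int_part (/ t (pos e k)) = (if e (pos e k) then 1 else 2)%Z).
  { intros j. symmetry. apply Int_part_spec. rewrite (inv_follows e t j He Ht).
    destruct (Ht (pos e (S j))) as [B _]. destruct (e (pos e j)); lra. }
  assert (Rem : cf_rem (t O) k = t (pos e k)).
  { induction k as [|k IH]; [reflexivity|]. cbn [cf_rem]. rewrite IH, Ent, (inv_follows e t k He Ht).
    destruct (e (pos e k)); ring. }
  split; [exact Rem|]. unfold cf_entry. rewrite Rem. apply Ent.
Qed.

Lemma follows_cf_bounded (e : nat -> bool) (t : nat -> R) :
  admissible e -> follows e t -> cf_bounded (t O).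
Proof.
  intros He Ht. exists 2%Z. intros n. rewrite (proj2 (cf_follows e t n He Ht)).
  destruct (e (pos e n)); lia.
Qed.

(** Every code position starts a digit or is the second symbol of a digit 2. *)
Lemma pos_reaches (e : nat -> bool) (q : nat) :
  exists k, pos e k = q \/ (S (pos e k) = q /\ e (pos e k) = false).
Proof.
  induction q as [|q [k [H|[H1 H2]]]].
  - exists O. now left.
  - destruct (e q) eqn:E.
    + exists (S k). left. simpl. now rewrite H, E.
    + exists k. right. now rewrite H.
  - exists (S k). left. simpl. now rewrite H2, H1.
Qed.

Lemma pos_le (e : nat -> bool) (k : nat) : (pos e k <= 2 * k)%nat.
Proof. induction k as [|k IH]; simpl; [lia|]. destruct (e (pos e k)); lia. Qed.

(** After a late zero come at least [p] digits 1 in a row; periodicity prolongs this run forever,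
    against the next zero. *)
Lemma zcode_not_periodic (z : nat -> nat) (t : nat -> R) :
  (forall k, (z k + 2 <= z (S k))%nat) ->
  (forall G, exists K, forall k, (K <= k)%nat -> (z k + G <= z (S k))%nat) ->
  follows (zcode z) t -> ~ cf_eventually_periodic (t O).
Proof.
  intros Hz Hg Ht [N [p [Hp Per]]].
  assert (He := zcode_admissible z Hz).
  assert (Per' : forall n, (N <= n)%nat ->
    zcode z (pos (zcode z) (n + p)) = zcode z (pos (zcode z) n)).
  { intros n Hn. specialize (Per n Hn).
    rewrite (proj2 (cf_follows _ t (n + p) He Ht)), (proj2 (cf_follows _ t n He Ht)) in Per.
    destruct (zcode z (pos (zcode z) (n + p))), (zcode z (pos (zcode z) n)); congruence. }
  set (e := zcode z) in *.
  (* Since a digit occupies at most two positions, [2 * N] ensures that the digit index [k] found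
     below is past [N]. The gap [p + 2] leaves [p] symbols [true] from position [z m + 2] on. *)
  destruct (Hg (p + 2)%nat) as [K HK]. set (m := (K + 2 * N)%nat).
  specialize (HK m ltac:(lia)).
  destruct (pos_reaches e (z m + 2)) as [k [Hk|[Hk1 Hk2]]].
  2:{ replace (pos e k) with (S (z m)) in Hk2 by lia.
      rewrite (He (z m) (zcode_at z Hz m)) in Hk2. discriminate. }
  assert (HkN : (N <= k)%nat).
  { assert (A := pos_le e k). assert (B := z_ge z Hz m). lia. }
  assert (All : forall i, pos e (k + i) = (z m + 2 + i)%nat /\ e (z m + 2 + i)%nat = true).
  { induction i as [i IH] using (well_founded_induction lt_wf).
    assert (Pi : pos e (k + i) = (z m + 2 + i)%nat).
    { destruct i as [|i]; [rewrite !Nat.add_0_r; exact Hk|].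
      destruct (IH i ltac:(lia)) as [A1 A2]. rewrite Nat.add_succ_r. cbn [pos].
      rewrite A1, A2. lia. }
    split; [exact Pi|].
    destruct (le_lt_dec p i) as [L|L].
    - rewrite <- Pi. destruct (IH (i - p)%nat ltac:(lia)) as [A1 A2].
      replace (k + i)%nat with (k + (i - p) + p)%nat by lia.
      rewrite Per', A1 by lia. exact A2.
    - replace (z m + 2 + i)%nat with (z m + 1 + (1 + i))%nat by lia.
      apply (zcode_agree_none z Hz (z m + 1) m); lia. }
  destruct (All (z (S m) - z m - 2)%nat) as [_ A].
  replace (z m + 2 + (z (S m) - z m - 2))%nat with (z (S m)) in A by lia.
  unfold e in A. rewrite (zcode_at z Hz) in A. discriminate.
Qed.

(** * The two numbers *)

(** For squares the gap at position [n] is of order [sqrt n]; for powers of 2 the gap after a zero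
    equals its position. The shifts in [k] keep all gaps at least 2, as admissibility demands. *)
Definition z_beta (k : nat) : nat := ((k + 2) * (k + 2))%nat.
Definition z_rho (k : nat) : nat := (2 ^ (k + 1))%nat.

Lemma z_beta_gap (k : nat) : (z_beta k + 2 <= z_beta (S k))%nat.
Proof. unfold z_beta. nia. Qed.

Lemma z_beta_gaps (G : nat) : exists K, forall k, (K <= k)%nat -> (z_beta k + G <= z_beta (S k))%nat.
Proof. exists G. intros k Hk. unfold z_beta. nia. Qed.

Lemma z_rho_S (k : nat) : z_rho (S k) = (2 * z_rho k)%nat.
Proof. reflexivity. Qed.

Lemma z_rho_gt (k : nat) : (k + 1 < z_rho k)%nat.
Proof. apply Nat.pow_gt_lin_r. lia. Qed.

Lemma z_rho_gap (k : nat) : (z_rho k + 2 <= z_rho (S k))%nat.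
Proof. rewrite z_rho_S. assert (A := z_rho_gt k). lia. Qed.

Lemma z_rho_gaps (G : nat) : exists K, forall k, (K <= k)%nat -> (z_rho k + G <= z_rho (S k))%nat.
Proof. exists G. intros k Hk. rewrite z_rho_S. assert (A := z_rho_gt k). lia. Qed.

Lemma z_rho_quadratic (k : nat) : ((k + 1) * (k + 1) <= 2 * z_rho k)%nat.
Proof.
  destruct k as [|[|k]]; [unfold z_rho; simpl; lia|unfold z_rho; simpl; lia|].
  induction k as [|k IH]; [unfold z_rho; simpl; lia|]. rewrite z_rho_S. nia.
Qed.

Lemma z_beta_next (n k : nat) : (n <= z_beta k)%nat ->
  (forall i, (i < k)%nat -> (z_beta i < n)%nat) ->
  (k * k <= 2 * n /\ z_beta (S k) - n <= 4 * k + 9)%nat.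
Proof.
  intros Hn Hk. destruct k as [|k]; [unfold z_beta in *; lia|].
  specialize (Hk k ltac:(lia)). unfold z_beta in *. nia.
Qed.

Lemma z_rho_next (n k : nat) : (forall i, (i < k)%nat -> (z_rho i < n)%nat) ->
  (k * k <= 2 * n /\ z_rho k <= 2 * n + 2)%nat.
Proof.
  intros Hk. destruct k as [|k]; [unfold z_rho; simpl; lia|].
  specialize (Hk k ltac:(lia)). rewrite z_rho_S. assert (A := z_rho_quadratic k).
  rewrite <- Nat.add_1_r. lia.
Qed.

(** Worst case: the next zero lies at [n + j], where [chi (Some j)] has its own. Agreement then ends
    at the following zero [2 (n + j)], which is [n + 2 j] symbols after [n]. *)
Lemma z_rho_disagree (o : option nat) : exists j, forall n,
  exists i, (i <= n + (2 * j + 2))%nat /\ zcode z_rho (n + i) <> chi o i.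
Proof.
  destruct o as [j|].
  - exists j. intros n. destruct (next_zero z_rho z_rho_gap n) as [k [Hk1 Hk2]].
    assert (A := z_rho_gap k).
    destruct (Nat.lt_trichotomy (z_rho k - n) j) as [L|[L|L]].
    + exists (z_rho k - n)%nat. split; [lia|].
      replace (n + (z_rho k - n))%nat with (z_rho k) by lia.
      rewrite (zcode_at z_rho z_rho_gap). simpl.
      destruct (Nat.eqb_spec (z_rho k - n) j); [lia|discriminate].
    + exists (z_rho (S k) - n)%nat. split; [rewrite z_rho_S; lia|].
      replace (n + (z_rho (S k) - n))%nat with (z_rho (S k)) by lia.
      rewrite (zcode_at z_rho z_rho_gap). unfold chi.
      destruct (Nat.eqb_spec (z_rho (S k) - n) j); [lia|discriminate].
    + exists j. split; [lia|].
      rewrite (zcode_agree z_rho z_rho_gap n k) by (auto; lia). simpl.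
      rewrite Nat.eqb_refl. destruct (Nat.eqb_spec j (z_rho k - n)); [lia|discriminate].
  - exists O. intros n. destruct (next_zero z_rho z_rho_gap n) as [k [Hk1 Hk2]].
    exists (z_rho k - n)%nat. split.
    + assert (A := z_rho_next n k Hk2). lia.
    + replace (n + (z_rho k - n))%nat with (z_rho k) by lia.
      rewrite (zcode_at z_rho z_rho_gap). discriminate.
Qed.

(** Starting [j] symbols before a zero, or just behind one for [None], agreement lasts until the
    next zero, at twice the position. *)
Lemma z_rho_agree (o : option nat) (N : nat) : exists n M, (N <= n)%nat /\ (n <= M + 2)%nat /\
  forall i, (i < M)%nat -> zcode z_rho (n + i) = chi o i.
Proof.
  destruct o as [j|].
  - remember (N + j)%nat as m eqn:Em. assert (A := z_rho_gt m).
    exists (z_rho m - j)%nat, (z_rho (S m) - (z_rho m - j))%nat.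
    split; [lia|]. split; [rewrite z_rho_S; lia|]. intros i Hi.
    replace j with (z_rho m - (z_rho m - j))%nat at 2 by lia.
    apply zcode_agree; [exact z_rho_gap|lia| |exact Hi].
    intros l Hl. destruct m as [|m']; [lia|].
    assert (B := z_rho_gt m'). rewrite z_rho_S.
    destruct (Nat.eq_dec l m') as [->|D]; [lia|].
    assert (E := z_mono z_rho z_rho_gap l m' ltac:(lia)). lia.
  - assert (A := z_rho_gt N).
    exists (z_rho N + 1)%nat, (z_rho (S N) - (z_rho N + 1))%nat.
    split; [lia|]. split; [rewrite z_rho_S; lia|]. intros i Hi.
    apply (zcode_agree_none z_rho z_rho_gap) with N; lia.
Qed.

(** Infinitely many times have agreement length 0. There the singular term is negligible for every
    exponent below 1, which yields the lower limit. *)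
Lemma zcode_mismatch (z : nat -> nat) (o : option nat) (N : nat) :
  (forall k, (z k + 2 <= z (S k))%nat) -> exists n, (N <= n)%nat /\ zcode z n <> chi o 0.
Proof.
  intros Hz. assert (A := z_ge z Hz N). destruct (chi o 0).
  - exists (z N). split; [exact A|]. rewrite (zcode_at z Hz). discriminate.
  - exists (S (z N)). split; [lia|]. rewrite (zcode_admissible z Hz _ (zcode_at z Hz N)). discriminate.
Qed.

(** * From the singular term to the limit, lower limit and upper limit *)

Section Limits.
Context (e : nat -> bool) (t : nat -> R) (al x : R).
Context (He : admissible e) (Ht : follows e t) (Hal : 0 < al < 1) (Hx : 0 < x <= 1).

Let total (n : nat) : R := ln (INR n) * P1n n (v (t O) al) x.
Let singular (n : nat) : R := ln (INR n) * sing e t al n x.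

Lemma regular_lim : is_lim_seq (fun n => total n - singular n) (mass e t al 0 * h1 x).
Proof.
  replace (mass e t al 0 * h1 x) with (mass e t al 0 / x) by (unfold h1; field; lra).
  apply is_lim_seq_ext with (2 := regular_part_lim e t al He Ht Hal x Hx).
  intros n. unfold total, singular. rewrite (P1n_split e t al n x). ring.
Qed.

Lemma regular_eventually (eps : R) : 0 < eps -> exists N, forall n, (N <= n)%nat ->
  Rabs (total n - singular n - mass e t al 0 * h1 x) < eps.
Proof.
  intros H. assert (L := regular_lim). apply is_lim_seq_spec in L.
  exact (L (mkposreal eps H)).
Qed.

Lemma singular_nonneg (n : nat) : (1 <= n)%nat -> x <> t n -> 0 <= singular n.
Proof.
  intros Hn Hd. unfold singular. apply Rmult_le_pos.
  - apply ln_nonneg. apply (le_INR 1). exact Hn.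
  - rewrite (sing_eq e t al He Ht Hal n) by (auto; lra). left. apply exp_pos.
Qed.

Lemma total_cv : (forall n, x <> t n) ->
  (forall eps, 0 < eps -> exists N, forall n, (N <= n)%nat -> singular n < eps) ->
  Un_cv total (mass e t al 0 * h1 x).
Proof.
  intros Hd Hs eps Heps.
  destruct (regular_eventually (eps / 2) ltac:(lra)) as [N1 H1].
  destruct (Hs (eps / 2) ltac:(lra)) as [N2 H2].
  exists (1 + N1 + N2)%nat. intros n Hn. unfold R_dist.
  specialize (H1 n ltac:(lia)). specialize (H2 n ltac:(lia)).
  assert (P := singular_nonneg n ltac:(lia) (Hd n)).
  apply Rabs_lt_between in H1. apply Rabs_lt_between. lra.
Qed.

Lemma total_liminf : (forall n, x <> t n) ->
  (forall eps, 0 < eps -> forall N, exists n, (N <= n)%nat /\ singular n < eps) ->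
  is_liminf total (mass e t al 0 * h1 x).
Proof.
  intros Hd Hs. split.
  - intros eps Heps. destruct (regular_eventually eps Heps) as [N1 H1].
    exists (1 + N1)%nat. intros n Hn. specialize (H1 n ltac:(lia)).
    assert (P := singular_nonneg n ltac:(lia) (Hd n)). apply Rabs_lt_between in H1. lra.
  - intros eps Heps N. destruct (regular_eventually (eps / 2) ltac:(lra)) as [N1 H1].
    destruct (Hs (eps / 2) ltac:(lra) (N + N1)%nat) as [n [Hn H2]].
    exists n. split; [lia|]. specialize (H1 n ltac:(lia)). apply Rabs_lt_between in H1. lra.
Qed.

Lemma total_limsup :
  (forall A N, exists n, (N <= n)%nat /\ A < singular n) -> limsup_is_pinfty total.
Proof.
  intros Hs M N. destruct (regular_eventually 1 ltac:(lra)) as [N1 H1].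
  destruct (Hs (M - mass e t al 0 * h1 x + 1) (N + N1)%nat) as [n [Hn H2]].
  exists n. split; [lia|]. specialize (H1 n ltac:(lia)). apply Rabs_lt_between in H1. lra.
Qed.

End Limits.

(** This keeps the points of the limit set off the orbit, so the value that [Rpower] assigns at the
    singularity never enters. *)
Lemma disagree_neq (e ch : nat -> bool) (t xs : nat -> R) (n B : nat) :
  follows e t -> follows ch xs -> admissible ch ->
  (exists i, (i <= B)%nat /\ e (n + i)%nat <> ch i) -> xs O <> t n.
Proof.
  intros Ht Hx Hc Hd E. assert (D := disagree_dist e ch t xs n B Ht Hx Hc Hd).
  rewrite E, Rminus_diag, Rabs_R0 in D. assert (Ph := phi_bounds).
  assert (P : 0 < phi ^ S B) by (apply pow_lt; lra).
  assert (0 < / (63 * (phi ^ S B * phi ^ S B))) by (apply Rinv_0_lt_compat; nra). lra.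
Qed.

Lemma sing_rho_large (o : option nat) (al A : R) (N : nat) : 1 / 2 < al < 1 ->
  exists n, (N <= n)%nat /\
    A < ln (INR n) * sing (zcode z_rho) (pt (zcode z_rho)) al n (pt (chi o) O).
Proof.
  intros Hal.
  assert (He := zcode_admissible z_rho z_rho_gap). assert (Ht := pt_follows _ He).
  assert (Hc := chi_admissible o). assert (Hx := pt_follows _ Hc).
  assert (Q := ln_phi_pos).
  (* With [M >= n - 2], the exponent in [sing_lower] is at least [c n - K]; [exp y >= 1 + y] makes
     linear growth enough. *)
  set (c := ln phi * (4 * al - 2)). assert (Pc : 0 < c) by (unfold c; nra).
  set (K := 6 * ln phi + 2 * ln 3 + 2 * ln 4).
  destruct (archimed ((A + K) / c)) as [Ar _].
  set (N0 := Z.to_nat (up ((A + K) / c))).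
  destruct (z_rho_agree o (3 + N + N0)) as [n [M [Hn [HM Ha]]]].
  destruct (z_rho_disagree o) as [j Hj].
  exists n. split; [lia|].
  assert (Hne : pt (zcode z_rho) n <> pt (chi o) O).
  { intros F. symmetry in F. revert F.
    apply (disagree_neq (zcode z_rho) (chi o) _ _ n (n + (2 * j + 2))); auto. }
  assert (S := sing_lower _ _ _ _ al He Ht Hc Hx ltac:(lra) n M (zeros_chi o M) Hne Ha).
  set (s := sing _ _ _ _ _) in *.
  assert (Hn0 : (A + K) / c < INR n).
  { apply Rlt_le_trans with (1 := Ar). apply Rle_trans with (INR N0).
    - unfold N0. destruct (Z_le_gt_dec 0 (up ((A + K) / c))) as [L|L].
      + rewrite INR_IZR_INZ, Z2Nat.id by exact L. lra.
      + apply Rle_trans with 0; [apply IZR_le; lia|apply pos_INR].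
    - apply le_INR. lia. }
  apply Rlt_div_l in Hn0; [|lra].
  assert (HM' : INR n - 2 <= INR M).
  { apply le_INR in HM. rewrite plus_INR in HM. simpl (INR 2) in HM. lra. }
  assert (Y : INR n * c - K <= ln phi * (2 * al * INR M - (2 - 2 * al) * (INR n + 1)) - 2 * ln 3 - 2 * ln 4).
  { assert (2 * al * (INR n - 2) <= 2 * al * INR M) by (apply Rmult_le_compat_l; lra).
    assert (ln phi * ((4 * al - 2) * INR n - 6) <= ln phi * (2 * al * INR M - (2 - 2 * al) * (INR n + 1)))
      by (apply Rmult_le_compat_l; lra).
    unfold c, K. lra. }
  assert (X := exp_ineq1_le (ln phi * (2 * al * INR M - (2 - 2 * al) * (INR n + 1)) - 2 * ln 3 - 2 * ln 4)).
  assert (L1 : 1 <= ln (INR n)).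
  { rewrite <- (ln_exp 1). apply ln_le; [apply exp_pos|]. apply Rle_trans with (1 := exp_le_3).
    replace 3 with (INR 3) by (simpl; ring). apply le_INR. lia. }
  assert (P : 0 < s) by (apply Rlt_le_trans with (2 := S); apply exp_pos).
  assert (1 * s <= ln (INR n) * s) by (apply Rmult_le_compat_r; lra). lra.
Qed.

Theorem theorem3p3 :
  exists beta rho : R,
    (0 < beta <= 1) /\ (0 < rho <= 1) /\
    irrational beta /\ cf_bounded beta /\ ~ cf_eventually_periodic beta /\
    irrational rho /\ cf_bounded rho /\ ~ cf_eventually_periodic rho /\
    (* (i) *)
    (forall alpha x : R, 0 < alpha < 1 -> Omega1 beta x ->
       exists I : R, improper_integral01 (v beta alpha) beta I /\
         Un_cv (fun n => ln (INR n) * P1n n (v beta alpha) x) (I * h1 x)) /\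
    (* (ii) *)
    (forall alpha x : R, 0 < alpha < 1/2 -> Omega1 rho x ->
       exists I : R, improper_integral01 (v rho alpha) rho I /\
         Un_cv (fun n => ln (INR n) * P1n n (v rho alpha) x) (I * h1 x)) /\
    (* (iii) *)
    (forall alpha x : R, 1/2 < alpha < 1 -> Omega1 rho x ->
       exists I : R, improper_integral01 (v rho alpha) rho I /\
         is_liminf (fun n => ln (INR n) * P1n n (v rho alpha) x) (I * h1 x) /\
         limsup_is_pinfty (fun n => ln (INR n) * P1n n (v rho alpha) x)).
Proof.
  assert (Hb := zcode_admissible z_beta z_beta_gap). assert (Fb := pt_follows _ Hb).
  assert (Hr := zcode_admissible z_rho z_rho_gap). assert (Fr := pt_follows _ Hr).
  assert (Fc : forall o, follows (chi o) (pt (chi o))) by (intros o; apply pt_follows, chi_admissible).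
  assert (Bb := proj1 (Fb O)). assert (Br := proj1 (Fr O)).
  assert (Bc : forall o, 0 < pt (chi o) O <= 1) by (intros o; destruct (Fc o O) as [B _]; lra).
  assert (Int : forall e al, follows e (pt e) -> 0 < al < 1 ->
    improper_integral01 (v (pt e O) al) (pt e O) (mass e (pt e) al 0)).
  { intros e al F Hal. destruct (F O) as [B _]. rewrite mass_0 by lra.
    apply improper_integral_v; lra. }
  assert (Ne : forall o n, pt (chi o) O <> pt (zcode z_rho) n).
  { intros o n. destruct (z_rho_disagree o) as [j Hj].
    apply (disagree_neq (zcode z_rho) (chi o) _ _ n (n + (2 * j + 2)));
      auto using chi_admissible. }
  exists (pt (zcode z_beta) O), (pt (zcode z_rho) O).
  split; [lra|]. split; [lra|].
  split; [now apply (follows_irrational (zcode z_beta))|].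
  split; [now apply (follows_cf_bounded (zcode z_beta))|].
  split; [now apply (zcode_not_periodic z_beta); auto using z_beta_gap, z_beta_gaps|].
  split; [now apply (follows_irrational (zcode z_rho))|].
  split; [now apply (follows_cf_bounded (zcode z_rho))|].
  split; [now apply (zcode_not_periodic z_rho); auto using z_rho_gap, z_rho_gaps|].
  split; [|split].
  - intros al x Hal HO.
    destruct (Omega1_zcode z_beta z_beta_gap _ x z_beta_gaps Fb HO) as [o ->].
    exists (mass (zcode z_beta) (pt (zcode z_beta)) al 0). split; [now apply Int|].
    apply (total_cv (zcode z_beta)); auto.
    + intros n. destruct (next_zero z_beta z_beta_gap n) as [k [Hk1 Hk2]].
      apply (disagree_neq (zcode z_beta) (chi o) _ _ n (z_beta (S k) - n)); auto using chi_admissible.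
      apply zcode_disagree; auto using z_beta_gap.
    + intros eps Heps.
      (* Agreement is at most [4 k + 9], so [2 al B <= 8 k + 18]; the rate [2 - 2 al] survives for
         every [al < 1]. *)
      destruct (sing_small _ _ _ _ al (2 - 2 * al) 18 Hb Fb (chi_admissible o) (Fc o) Hal ltac:(lra)
        eps Heps) as [N HN].
      exists N. intros n Hn. destruct (next_zero z_beta z_beta_gap n) as [k [Hk1 Hk2]].
      destruct (z_beta_next n k Hk1 Hk2) as [A1 A2].
      apply (HN n Hn k (z_beta (S k) - n)%nat A1).
      * apply zeros_zcode; auto using z_beta_gap.
      * apply zcode_disagree; auto using z_beta_gap.
      * apply le_INR in A2. rewrite plus_INR, mult_INR in A2.
        replace (INR 4) with 4 in A2 by (simpl; ring). replace (INR 9) with 9 in A2 by (simpl; ring).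
        set (B := INR (z_beta (S k) - n)) in *. assert (Pk := pos_INR k).
        assert (al * B <= al * (4 * INR k + 9)) by (apply Rmult_le_compat_l; lra).
        assert (al * INR k <= 1 * INR k) by (apply Rmult_le_compat_r; lra). lra.
  - intros al x Hal HO.
    destruct (Omega1_zcode z_rho z_rho_gap _ x z_rho_gaps Fr HO) as [o ->].
    exists (mass (zcode z_rho) (pt (zcode z_rho)) al 0). split; [apply Int; auto; lra|].
    apply (total_cv (zcode z_rho)); auto; [lra|].
    intros eps Heps. destruct (z_rho_disagree o) as [j Hj].
    (* Agreement up to [n + 2 j + 2] lowers the rate from [2 - 2 al] to [2 - 4 al], positive exactly
       for [al < 1/2]. *)
    destruct (sing_small _ _ _ _ al (2 - 4 * al) (4 * INR j + 4) Hr Fr (chi_admissible o) (Fc o)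
      ltac:(lra) ltac:(lra) eps Heps) as [N HN].
    exists N. intros n Hn. destruct (next_zero z_rho z_rho_gap n) as [k [Hk1 Hk2]].
    apply (HN n Hn k (n + (2 * j + 2))%nat).
    + now apply z_rho_next.
    + apply zeros_zcode; auto using z_rho_gap.
    + apply Hj.
    + rewrite !plus_INR, mult_INR. simpl (INR 2). assert (Pk := pos_INR k). assert (Pj := pos_INR j).
      assert (0 <= al * INR k) by (apply Rmult_le_pos; lra).
      assert (al * INR j <= 1 * INR j) by (apply Rmult_le_compat_r; lra). lra.
  - intros al x Hal HO.
    destruct (Omega1_zcode z_rho z_rho_gap _ x z_rho_gaps Fr HO) as [o ->].
    exists (mass (zcode z_rho) (pt (zcode z_rho)) al 0). split; [apply Int; auto; lra|]. split.
    + apply (total_liminf (zcode z_rho)); auto; [lra|].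
      intros eps Heps N0.
      destruct (sing_small _ _ _ _ al (2 - 2 * al) 0 Hr Fr (chi_admissible o) (Fc o)
        ltac:(lra) ltac:(lra) eps Heps) as [N HN].
      destruct (zcode_mismatch z_rho o (N0 + N) z_rho_gap) as [n [Hn Hm]].
      exists n. split; [lia|]. destruct (next_zero z_rho z_rho_gap n) as [k [Hk1 Hk2]].
      apply (HN n ltac:(lia) k O).
      * now apply z_rho_next.
      * apply zeros_zcode; auto using z_rho_gap.
      * exists O. split; [lia|]. now rewrite Nat.add_0_r.
      * simpl (INR 0). assert (Pk := pos_INR k).
        assert (0 <= al * INR k) by (apply Rmult_le_pos; lra). lra.
    + apply (total_limsup (zcode z_rho)); auto; [lra|].
      intros A N. now apply sing_rho_large.
Qed.
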